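(* Assume the setting and standing assumptions described in the context. Assume moreover that $\operatorname{Im}\mathbb{B}=\mathcal{Q}'$, i.e. there exists $\beta>0$ such that $$\sup_{v\in\mathcal{V}\setminus\{0\}}\frac{b(v,q)}{\|v\|_{\mathcal{V}}}\ge\beta\|q\|_{\mathcal{Q}}\quad\forall q\in\mathcal{Q},$$ and that $c(p,q)=\lambda(p,q)_{\mathcal{Q}}$ with $\lambda>0$. Then for every $f\in L^1_{\mathcal{J}}(\mathcal{V}')$ and every $g\in L^1_{\mathcal{J}}(\mathcal{Q}')$ there is a unique $(u,p)\in L^1_{\mathcal{J}}(\mathcal{V}\times\mathcal{Q})$ such that, for a.e. $t\in\mathcal{J}$, $$\begin{aligned}\mathbb{A}u(t)+\mathbb{B}^*p(t)&=f(t)+\int_0^t\big[k_1(t,s)\mathbb{A}u(s)+k_2(t,s)\mathbb{B}^*p(s)\big]ds,\\ \mathbb{B}u(t)-\lambda\mathfrak{R}_{\mathcal{Q}}p(t)&=g(t).\end{aligned}$$ Moreover, there exist positive constants $C_1,C_2,C_3,C_4$, all uniform with respect to $\lambda$, such that $$\|u\|_{L^1_{\mathcal{J}}(\mathcal{V})}\le C_1\|f\|_{L^1_{\mathcal{J}}(\mathcal{V}')}+C_2\|g\|_{L^1_{\mathcal{J}}(\mathcal{Q}')},\qquad \|p\|_{L^1_{\mathcal{J}}(\mathcal{Q})}\le C_3\|f\|_{L^1_{\mathcal{J}}(\mathcal{V}')}+C_4\|g\|_{L^1_{\mathcal{J}}(\mathcal{Q}')}.$$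
   Context: $\mathcal{V},\mathcal{Q}$ are real Hilbert spaces with duals $\mathcal{V}',\mathcal{Q}'$; $(\cdot,\cdot)_{\mathcal{Q}}$ is the inner product of $\mathcal{Q}$; $\mathcal{J}=[0,T]$ with $T\in[0,\infty)$; $L^1_{\mathcal{J}}(\mathcal{B})$ denotes the Bochner space $L^1(\mathcal{J};\mathcal{B})$. $a:\mathcal{V}\times\mathcal{V}\to\mathbb{R}$, $b:\mathcal{V}\times\mathcal{Q}\to\mathbb{R}$ and $c:\mathcal{Q}\times\mathcal{Q}\to\mathbb{R}$ are continuous bilinear forms; $\mathbb{A}:\mathcal{V}\to\mathcal{V}'$ and $\mathbb{B}:\mathcal{V}\to\mathcal{Q}'$ are the induced operators ($\langle\mathbb{A}w,v\rangle=a(w,v)$, $\langle\mathbb{B}v,q\rangle=b(v,q)$), and $\mathbb{B}^*:\mathcal{Q}\to\mathcal{V}'$ is the transpose of $\mathbb{B}$. $\mathcal{K}=\ker\mathbb{B}$, $\mathcal{H}=\ker\mathbb{B}^*$. Standing assumptions: $a$ and $c$ are symmetric and positive semi-definite, and there are $\alpha_0,\gamma_0>0$ with $a(v_0,v_0)\ge\alpha_0\|v_0\|_{\mathcal{V}}^2$ for all $v_0\in\mathcal{K}$ and $c(q_0,q_0)\ge\gamma_0\|q_0\|_{\mathcal{Q}}^2$ for all $q_0\in\mathcal{H}$ (the assumptions on $c$ hold automatically, with $\gamma_0=\lambda$, for $c=\lambda(\cdot,\cdot)_{\mathcal{Q}}$). $\mathfrak{R}_{\mathcal{Q}}:\mathcal{Q}\to\mathcal{Q}'$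 is the Riesz operator. The kernels $k_1,k_2$ are continuous bounded real functions on the triangle $\{(t,s):0\le s\le t\le T\}$.
   Formalization: C₂, C₃, C₄ are uniform in all λ>0, but C₁ is uniform only on each bounded range 0<λ≤Λ; a C₁ uniform over all λ>0 is impossible in general (V=Q=ℝ, b(v,q)=vq, a=0, k₁=k₂=0 gives u=g+λf). *)

(* Defs.v *)
From HB Require Import structures.
From mathcomp Require Import all_boot all_order all_algebra.
From mathcomp Require Import all_classical all_reals all_analysis.
From mathcomp Require Import ring lra.

Set Implicit Arguments.
Unset Strict Implicit.
Unset Printing Implicit Defensive.

Import Order.TTheory GRing.Theory Num.Theory.
Import numFieldNormedType.Exports.

Local Open Scope classical_set_scope.
Local Open Scope ring_scope.

HB.mixin Record CompleteNormedModule_isHilbert (R : realType) V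
    & CompleteNormedModule R V := {
  inner : V -> V -> R ;
  innerC : forall x y, inner x y = inner y x ;
  innerPl : forall (k : R) x y z,
    inner (k *: x + y) z = k * inner x z + inner y z ;
  inner_norm : forall x, inner x x = `|x| ^+ 2
}.

#[short(type="hilbertType")]
HB.structure Definition Hilbert (R : realType) :=
  {V of CompleteNormedModule R V & CompleteNormedModule_isHilbert R V}.

(* The dual space V', with the operator norm. *)
Section dual.
Context {R : realType} {V : normedModType R}.

Definition dual_pred : {pred V -> R^o} :=
  fun f => `[< linear f /\ continuous f >].

Record dual := Dual { dual_fun :> V -> R^o ; _ : dual_fun \in dual_pred }.

HB.instance Definition _ := [isSub for dual_fun].
HB.instance Definition _ := [Choice of dual by <:].

Lemma dual_submod_closed : submod_closed dual_pred.
Proof.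
split=> [|k f g /asboolP[lf cf] /asboolP[lg cg]]; apply/asboolP; split.
- by move=> k x y; rewrite /= scaler0 addr0.
- exact: cst_continuous.
- move=> l x y /=; rewrite !fctE /= lf lg.
  by rewrite !scalerDr !scalerA (mulrC k) -!addrA; congr (_ + _); rewrite addrCA.
- move=> x; apply: (@continuousD _ _ _ (k \*: f) g); last exact: cg.
  by apply: continuousZl_tmp; exact: cf.
Qed.

HB.instance Definition _ := GRing.isSubmodClosed.Build R (V -> R^o) dual_pred
  dual_submod_closed.
HB.instance Definition _ := [SubChoice_isSubLmodule of dual by <:].

Lemma dual_linear (f : dual) : linear f.
Proof. by case: f => f /= /asboolP[]. Qed.

Lemma dual_continuous (f : dual) : continuous f.
Proof. by case: f => f /= /asboolP[]. Qed.


HB.instance Definition _ (f : dual) :=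
  GRing.isLinear.Build R V R^o *:%R f (dual_linear f).

Definition dual_norm (f : dual) : R :=
  sup [set `|f x| | x in [set x | `|x| <= 1]].

Lemma dual_bounded (f : dual) :
  exists2 M, 0 < M & forall x, `|f x| <= M * `|x|.
Proof.
have /linear_boundedP/pinfty_ex_gt0[M M0 fM] :=
  @continuous_linear_bounded _ _ _ 0 f (@dual_continuous f 0).
by exists M.
Qed.

Lemma dual_has_sup (f : dual) : has_sup [set `|f x| | x in [set x | `|x| <= 1]].
Proof.
split; first by exists `|f 0|, 0 => //=; rewrite normr0.
have [M M0 fM] := dual_bounded f; exists M => _ [x /= x1 <-].
by rewrite (le_trans (fM x))// ger_pMr.
Qed.

Lemma dual_normP (f : dual) x : `|f x| <= dual_norm f * `|x|.
Proof.
have [->|x0] := eqVneq x 0; first by rewrite linear0 !normr0 mulr0.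
have nx : 0 < `|x| by rewrite normr_gt0.
rewrite -ler_pdivrMr//; apply: sup_upper_bound; first exact: dual_has_sup.
exists (`|x|^-1 *: x) => /=.
  by rewrite normrZ gtr0_norm ?invr_gt0// mulVf ?gt_eqF.
by rewrite linearZ/= normrM gtr0_norm ?invr_gt0// mulrC.
Qed.

Lemma dual_norm_le (f : dual) M :
  (forall x, `|x| <= 1 -> `|f x| <= M) -> dual_norm f <= M.
Proof.
move=> fM; apply: ge_sup => [|_ [x /= x1 <-]]; last exact: fM.
by case: (dual_has_sup f).
Qed.

Lemma dual_norm_ge0 (f : dual) : 0 <= dual_norm f.
Proof.
apply: sup_upper_bound; first exact: dual_has_sup.
by exists 0; rewrite /= ?linear0 normr0.
Qed.

Lemma dual_eqP (f g : dual) : f =1 g -> f = g.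
Proof. by move=> fg; apply: val_inj; apply/funext. Qed.

Lemma dual_normD (f g : dual) : dual_norm (f + g) <= dual_norm f + dual_norm g.
Proof.
apply: dual_norm_le => x x1; rewrite (le_trans (ler_normD _ _))//.
by apply: lerD; rewrite (le_trans (dual_normP _ x))// ler_piMr ?dual_norm_ge0.
Qed.

Lemma dual_normZ_le (k : R) (f : dual) : dual_norm (k *: f) <= `|k| * dual_norm f.
Proof.
apply: dual_norm_le => x x1; rewrite [leLHS]normrM ler_wpM2l//.
by rewrite (le_trans (dual_normP _ x))// ler_piMr ?dual_norm_ge0.
Qed.

Lemma dual_normZ (k : R) (f : dual) : dual_norm (k *: f) = `|k| * dual_norm f.
Proof.
apply/eqP; rewrite eq_le dual_normZ_le/=.
have [->|k0] := eqVneq k 0; first by rewrite normr0 mul0r dual_norm_ge0.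
have := dual_normZ_le k^-1 (k *: f).
by rewrite scalerA mulVf// scale1r normfV ler_pdivlMl ?normr_gt0.
Qed.

Lemma dual_norm0_eq0 (f : dual) : dual_norm f = 0 -> f = 0.
Proof.
move=> f0; apply: dual_eqP => x; apply/eqP.
by rewrite -normr_le0 (le_trans (dual_normP f x))// f0 mul0r.
Qed.

HB.instance Definition _ := Lmodule_isNormed.Build R dual
  dual_normD dual_normZ dual_norm0_eq0.

End dual.
Arguments dual {R} V.

(* Continuous bilinear forms; continuity is joint. *)
Record cbilinear (R : realType) (V W : normedModType R) := CBilinear {
  cbilinear_form :> {bilinear V -> W -> R | *%R & *%R} ;
  cbilinear_continuous : continuous (fun z : V * W => cbilinear_form z.1 z.2)
}.

Section operators.
Context {R : realType} {V W : normedModType R}.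

Section induced.
Variable b : cbilinear V W.

Lemma form_op_subproof (v : V) : (b v : W -> R^o) \in dual_pred.
Proof.
apply/asboolP; split=> [k x y|x]; first by rewrite linearPr.
apply: (@continuous_comp _ _ _ (fun w => (v, w)) (fun z => b z.1 z.2)).
  by apply: cvg_pair; [exact: cvg_cst|exact: cvg_id].
exact: cbilinear_continuous.
Qed.

(* The operator V -> W' with <form_op b v, w> = b v w. *)
Definition form_op (v : V) : dual W := Dual (form_op_subproof v).

Definition flip_form : W -> V -> R := fun w v => b v w.

Lemma flip_bilinear : bilinear_for
  (GRing.Scale.Law.clone _ _ *%R _) (GRing.Scale.Law.clone _ _ *%R _) flip_form.
Proof.
by split=> x k u v; rewrite /flip_form ?linearPl ?linearPr.
Qed.

HB.instance Definition _ :=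
  bilinear_isBilinear.Build R W V R *%R *%R flip_form flip_bilinear.

Lemma flip_continuous : continuous (fun z : W * V => flip_form z.1 z.2).
Proof.
move=> z; apply: (@continuous_comp _ _ _ (fun z : W * V => (z.2, z.1))
  (fun z : V * W => b z.1 z.2)); last exact: cbilinear_continuous.
by apply: cvg_pair; [exact: cvg_snd|exact: cvg_fst].
Qed.

(* The form of the transpose operator: <form_op flip w, v> = b v w. *)
Definition flip : cbilinear W V := CBilinear flip_continuous.

End induced.
End operators.

Section riesz.
Context {R : realType} {Q : hilbertType R}.

Definition inner_form : Q -> Q -> R := inner.

Lemma inner_bilinear : bilinear_for
  (GRing.Scale.Law.clone _ _ *%R _) (GRing.Scale.Law.clone _ _ *%R _) inner_form.
Proof.
by split=> x k u v; rewrite /inner_form ?(innerC x) innerPl// !(innerC _ x).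
Qed.

HB.instance Definition _ :=
  bilinear_isBilinear.Build R Q Q R *%R *%R inner_form inner_bilinear.

Lemma inner_polar (x y : Q) :
  inner x y = 2^-1 * (`|x + y| ^+ 2 - `|x| ^+ 2 - `|y| ^+ 2).
Proof.
have innerDl u v w : inner (u + v) w = inner u w + inner v w :> R.
  by rewrite -[u in LHS]scale1r innerPl mul1r.
rewrite -!inner_norm innerDl !(innerC _ (x + y)) !innerDl (innerC y x).
by field.
Qed.

Lemma inner_continuous : continuous (fun z : Q * Q => inner_form z.1 z.2).
Proof.
rewrite (_ : (fun _ => _) = fun z : Q * Q =>
  2^-1 * (`|z.1 + z.2| ^+ 2 - `|z.1| ^+ 2 - `|z.2| ^+ 2)); last first.
  by apply/funext => z; exact: inner_polar.
move=> z; have c1 : (fun z : Q * Q => z.1) @ z --> z.1 by exact: cvg_fst.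
have c2 : (fun z : Q * Q => z.2) @ z --> z.2 by exact: cvg_snd.
apply: cvgM; first exact: cvg_cst.
apply: cvgB; [apply: cvgB|].
- by rewrite expr2; apply: cvgM; apply: cvg_norm; exact: cvgD.
- by rewrite expr2; apply: cvgM; apply: cvg_norm.
- by rewrite expr2; apply: cvgM; apply: cvg_norm.
Qed.

Definition inner_cbilinear : cbilinear Q Q := CBilinear inner_continuous.

Definition riesz : Q -> dual Q := form_op inner_cbilinear.

End riesz.

(* Bochner integration with respect to the Lebesgue measure.  Functions are
   total on R; only their values on the set D matter, up to null sets.
   [lebesgue_measure] lives on the Borel sets, which loses nothing since strong
   measurability only asks for almost everywhere convergence. *)
Section bochner.
Context {R : realType} {B : normedModType R}.
Local Notation mu := (@lebesgue_measure R).
Implicit Types (D : set R) (f : R -> B).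

Definition simple_fun D (s : R -> B) : Prop :=
  [/\ finite_set (range s),
      forall y, measurable (s @^-1` [set y]) &
      forall y, y != 0 -> (mu (D `&` s @^-1` [set y]) < +oo)%E].

Definition simple_integral D (s : R -> B) : B :=
  \sum_(y \in range s) fine (mu (D `&` s @^-1` [set y])) *: y.

Definition strongly_measurable D f : Prop :=
  exists s : nat -> R -> B, (forall n, simple_fun D (s n)) /\
    {ae mu, forall t, D t -> s n t @[n --> \oo] --> f t}.

Definition L1norm D f : \bar R := (\int[mu]_(t in D) `|f t|%:E)%E.

Definition L1 D f : Prop := strongly_measurable D f /\ (L1norm D f < +oo)%E.

(* Strong measurability has to be required: the library integral is a lower
   integral on nonmeasurable functions, so the convergence of the L1 norms alone
   would not determine I. *)
Definition is_bochner_integral D f (I : B) : Prop :=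
  strongly_measurable D f /\
  exists s : nat -> R -> B, [/\ forall n, simple_fun D (s n),
    L1norm D (f \- s n) @[n --> \oo] --> (0 : \bar R) &
    simple_integral D (s n) @[n --> \oo] --> I].

(* Equal to 0 when f has no Bochner integral. *)
Definition bochner_integral D f : B := xget 0 [set I | is_bochner_integral D f I].

End bochner.

Definition triangle (R : realType) (T : R) : set (R * R) :=
  [set z | [/\ 0 <= z.2, z.2 <= z.1 & z.1 <= T]].

Definition kernel_on_triangle (R : realType) (T : R) (k : R -> R -> R) : Prop :=
  {within triangle T, continuous (fun z : R * R => k z.1 z.2)} /\
  [bounded k z.1 z.2 | z in triangle T].

Section problem.
Context {R : realType} {V Q : hilbertType R}.
Variables (a : cbilinear V V) (b : cbilinear V Q).
Local Notation A := (form_op a).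
Local Notation B := (form_op b).
Local Notation Bt := (form_op (flip b)).

(* When V = 0 the supremum is [sup set0 = 0], so that the condition then says
   Q = 0; this is what surjectivity of the operator V -> Q' means there. *)
Definition inf_sup (beta : R) : Prop := forall q : Q,
  beta * `|q| <= sup [set b v q / `|v| | v in [set v : V | v != 0]].

Definition volterra_solution (T : R) (k1 k2 : R -> R -> R) (lambda : R)
    (f : R -> dual V) (g : R -> dual Q) (up : R -> V * Q) : Prop :=
  {ae @lebesgue_measure R, forall t, `[0, T]%classic t ->
    let u s := (up s).1 in let p s := (up s).2 in
    A (u t) + Bt (p t) = f t + bochner_integral `[0, t]
      (fun s => k1 t s *: A (u s) + k2 t s *: Bt (p s)) /\
    B (u t) - lambda *: riesz (p t) = g t}.

End problem.

(* Main.v *)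
(* For fixed t the system is a saddle point problem whose right-hand side
   f(t) + (memory) involves the unknowns only through a Volterra integral.
   Eliminating p turns the saddle point problem into a coercive symmetric one,
   and the energy identity bounds |p| by |F| + |G| uniformly in lambda, and |u|
   by C1(lambda) |F| + C |G|.  Existence is a fixed point for the memory term,
   which is continuous in t, in a sup norm with exponential weight.

   For the bounds, m = |A u| + |B^* p| is controlled by |F| + |G| uniformly in
   lambda, so Gronwall's lemma for m gives the bound on p.  Bounding u through
   the memory term would bring C1(lambda) into the coefficient of g.  Instead,
   w = u - int k1 u and pi = p - int k2 p solve the saddle point problem with
   right-hand side f and g - int k1 B u + int k2 lambda R p, where
   lambda R p = B u - g, and Gronwall's lemma is applied to |u|.

   Integrals of V-valued functions are taken weakly, through the Riesz
   representation; the Bochner integral in V' acts on vectors as such a weak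
   integral. *)
Require Import Defs.
From mathcomp Require Import all_boot all_order all_algebra.
From mathcomp Require Import all_classical all_reals all_analysis.
From mathcomp Require Import measurable_realfun ring lra.

Set Implicit Arguments.
Unset Strict Implicit.
Unset Printing Implicit Defensive.

Import Order.TTheory GRing.Theory Num.Theory.
Import numFieldNormedType.Exports.

Local Open Scope classical_set_scope.
Local Open Scope ring_scope.

(** The data are only integrable in time, so u and p have no sup norm, whereas the memory term has
    one; taking it as the unknown of the fixed point keeps the iteration among continuous functions.
    Since a may degenerate outside the kernel of B, the energy a u u does not control |u|; it does
    control A u, by |A u|^2 <= M a u u, and this is why the Gronwall argument for p runs on |A u|.
    The parameter lambda enters the bound on u only through lambda |p|, because B u = G + lambda p.
    Data and solutions are given up to null sets, and their L1 norms are integrals of possibly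
    nonmeasurable functions. Each function is therefore replaced by a Borel representative, an
    everywhere limit of finitely valued functions, before any estimate is made. Uniqueness is the
    estimates applied to the difference of two solutions, whose data are zero. *)

Section dual_theory.
Context {R : realType} {V : normedModType R}.
Implicit Types f g : dual V.

Lemma dualD f x y : f (x + y) = f x + f y :> R.
Proof. exact: linearD. Qed.

Lemma dualZ f (k : R) x : f (k *: x) = k * f x :> R.
Proof. exact: linearZ. Qed.

Lemma dual_boundedP f x : `|f x : R| <= `|f| * `|x|.
Proof. exact: dual_normP. Qed.

Lemma dual_norm_lub f (M : R) : 0 <= M -> (forall x, `|f x : R| <= M * `|x|) -> `|f| <= M.
Proof.
move=> M0 fM; apply: dual_norm_le => x x1; apply: le_trans (fM x) _.
by rewrite ler_piMr.
Qed.

End dual_theory.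

(** * Inner products and elementary inequalities *)

Section inner_product.
Context {R : realType} {V : hilbertType R}.
Implicit Types x y z : V.

Lemma innerDl x y z : inner (x + y) z = inner x z + inner y z :> R.
Proof. by rewrite -[x in LHS]scale1r innerPl mul1r. Qed.

Lemma inner0l x : inner 0 x = 0 :> R.
Proof. by apply: (addrI (inner 0 x)); rewrite -innerDl !addr0. Qed.

Lemma innerZl (k : R) x y : inner (k *: x) y = k * inner x y.
Proof. by rewrite -[k *: x]addr0 innerPl inner0l addr0. Qed.

Lemma innerNl x y : inner (- x) y = - inner x y :> R.
Proof. by rewrite -scaleN1r innerZl mulN1r. Qed.

Lemma innerBl x y z : inner (x - y) z = inner x z - inner y z :> R.
Proof. by rewrite innerDl innerNl. Qed.

Lemma innerDr x y z : inner x (y + z) = inner x y + inner x z :> R.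
Proof. by rewrite !(innerC x) innerDl. Qed.

Lemma innerZr (k : R) x y : inner x (k *: y) = k * inner x y.
Proof. by rewrite !(innerC x) innerZl. Qed.

Lemma innerBr x y z : inner x (y - z) = inner x y - inner x z :> R.
Proof. by rewrite !(innerC x) innerBl. Qed.

Lemma inner_Cauchy_Schwarz x y : `|inner x y : R| <= `|x| * `|y|.
Proof.
have [->|y0] := eqVneq y 0; first by rewrite innerC inner0l !normr0 mulr0.
have ny : 0 < `|y| by rewrite normr_gt0.
have nxy : 0 <= `|x| * `|y| by rewrite mulr_ge0.
have key : inner x y ^+ 2 <= (`|x| * `|y|) ^+ 2 :> R.
  have := sqr_ge0 `| `|y| ^+ 2 *: x - inner x y *: y |.
  rewrite -inner_norm innerBl !innerBr !innerZl !innerZr !inner_norm (innerC y x).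
  set i := inner x y => h.
  have {h} : 0 <= `|y| ^+ 2 * ((`|x| * `|y|) ^+ 2 - i ^+ 2).
    by apply: le_trans h _; rewrite le_eqVlt; apply/orP; left; apply/eqP; ring.
  by rewrite pmulr_rge0 ?exprn_gt0// subr_ge0.
rewrite -[leRHS]ger0_norm// -sqrtr_sqr -[leRHS]sqrtr_sqr.
exact: ler_wsqrtr.
Qed.

Lemma inner_nondegenerate x y : (forall z, inner x z = inner y z :> R) -> x = y.
Proof.
move=> xy; apply/eqP; rewrite -subr_eq0 -normr_eq0 -sqrf_eq0 -inner_norm.
by rewrite innerBl xy subrr.
Qed.

End inner_product.

(** For c > 0 the value at s = - d / c gives the bound. For c = 0 the expression is affine in s, and
    a nonzero slope would make it negative at the s with 2 s d = - (e + 1). The term e leaves room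
    for approximate minimisers, where the gradient is small rather than zero. *)
Lemma nonneg_quadratic_discr (R : realFieldType) (e d c : R) : 0 <= c ->
  (forall s, 0 <= e + 2 * s * d + s ^+ 2 * c) -> d ^+ 2 <= e * c.
Proof.
move=> c0 h; move: c0; rewrite le_eqVlt => /orP[/eqP c0|c0].
  suff -> : d = 0 by rewrite -c0 expr0n mulr0.
  apply/eqP; apply/negPn/negP => d0.
  have := h (- (e + 1) / (2 * d)); rewrite -c0 mulr0 addr0.
  rewrite (_ : 2 * _ * d = - (e + 1)); last by field.
  lra.
have := h (- d / c).
rewrite (_ : _ + _ = (e * c - d ^+ 2) / c); last by field; rewrite gt_eqF.
by rewrite pmulr_lge0 ?invr_gt0// subr_ge0.
Qed.

Lemma invn_lt (R : realType) (e : R) : 0 < e ->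
  exists N : nat, forall n, (N <= n)%N -> n.+1%:R^-1 < e.
Proof.
move=> e0; exists (Num.truncn e^-1) => n Nn.
rewrite invf_plt ?posrE//; apply: lt_le_trans (truncnS_gt _) _.
by rewrite ler_nat ltnS.
Qed.

Lemma cauchy_seq_cvg (R : realType) (V : completeNormedModType R) (x : nat -> V) :
  (forall e : R, 0 < e ->
    exists N : nat, forall m n, (N <= m)%N -> (N <= n)%N -> `|x m - x n| < e) ->
  exists l : V, x n @[n --> \oo] --> l.
Proof.
move=> xc; apply/cvg_ex; apply: cauchy_cvg; apply: cauchy_exP => e e0.
have [N hN] := xc e e0; exists (x N).
by exists N => // n /= Nn; rewrite -ball_normE /=; exact: hN.
Qed.

(** * Symmetric coercive problems *)

Section lax_milgram.
Context {R : realType} {V : completeNormedModType R}.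
Variables (A : V -> V -> R) (M alpha : R).
Hypothesis A_linear : forall k x y z, A (k *: x + y) z = k * A x z + A y z.
Hypothesis A_sym : forall x y, A x y = A y x.
Hypothesis A_bounded : forall x y, `|A x y| <= M * `|x| * `|y|.
Hypothesis alpha_gt0 : 0 < alpha.
Hypothesis A_coercive : forall x, alpha * `|x| ^+ 2 <= A x x.

Let ADl x y z : A (x + y) z = A x z + A y z.
Proof. by rewrite -[x in LHS]scale1r A_linear mul1r. Qed.
Let A0l x : A 0 x = 0.
Proof. by apply: (addrI (A 0 x)); rewrite -ADl !addr0. Qed.
Let AZl (k : R) x y : A (k *: x) y = k * A x y.
Proof. by rewrite -[k *: x]addr0 A_linear A0l addr0. Qed.
Let ADr x y z : A x (y + z) = A x y + A x z.
Proof. by rewrite !(A_sym x) ADl. Qed.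
Let AZr (k : R) x y : A x (k *: y) = k * A x y.
Proof. by rewrite !(A_sym x) AZl. Qed.

(* The solution minimises J v = A v v - 2 F v; coercivity turns minimising
   sequences into Cauchy sequences. *)
Lemma lax_milgram_sym (F : dual V) : exists u, forall v, A u v = F v.
Proof.
pose J v := A v v - 2 * F v.
have J_lb v : - (`|F| ^+ 2 / alpha) <= J v.
  have Fv : F v <= `|F| * `|v| := le_trans (ler_norm _) (dual_normP F v).
  have := A_coercive v; rewrite /J.
  have : 0 <= (`|F| - alpha * `|v|) ^+ 2 / alpha.
    by rewrite divr_ge0 ?sqr_ge0// ltW.
  rewrite (_ : _ / alpha = `|F| ^+ 2 / alpha - 2 * (`|F| * `|v|) + alpha * `|v| ^+ 2).
    lra.
  by field; rewrite gt_eqF.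
pose m := inf (range J).
have J_inf : has_inf (range J).
  by split; [exists (J 0), 0|exists (- (`|F| ^+ 2 / alpha)) => _ [v _ <-]].
have mJ v : m <= J v by apply: ge_inf; [case: J_inf|exists v].
have /choice[x xm] n : exists v, J v < m + n.+1%:R^-1.
  have [|_ [v _ <-] ?] := @inf_adherent _ _ n.+1%:R^-1 _ J_inf.
    by rewrite invr_gt0.
  by exists v.
(* J at the midpoint is at least m, and 2 J (x p) + 2 J (x n) minus four times that value is A (x p
   - x n) (x p - x n). *)
have parallelogram p n : alpha * `|x p - x n| ^+ 2 <= 2 * p.+1%:R^-1 + 2 * n.+1%:R^-1.
  apply: (le_trans (A_coercive _)).
  have := mJ (2^-1 *: (x p + x n)); have := xm p; have := xm n; rewrite /J.
  rewrite -[- x n]scaleN1r dualZ dualD.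
  rewrite !AZl !AZr !ADl !ADr !AZl !AZr (A_sym (x n) (x p)).
  move: (A (x p) (x p)) (A (x n) (x n)) (A _ _) (F _) (F (x n)) (_^-1) (n.+1%:R^-1) => *.
  lra.
have [u xu] : exists u : V, x n @[n --> \oo] --> u.
  apply: cauchy_seq_cvg => e e0.
  have [|N hN] := @invn_lt R (alpha * e ^+ 2 / 4).
    by rewrite divr_gt0// mulr_gt0// exprn_gt0.
  exists N => p n Np Nn.
  have := parallelogram p n; have := hN _ Np; have := hN _ Nn => h1 h2 h3.
  have : alpha * `|x p - x n| ^+ 2 < alpha * e ^+ 2.
    move: (alpha * _) (alpha * _) (p.+1%:R^-1) (n.+1%:R^-1) h1 h2 h3 => *.
    lra.
  by rewrite ltr_pM2l// ltr_pXn2r ?nnegrE// ltW.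
(* J stays above m on the line x n + s v, and J (x n) exceeds m by less than 1 / (n + 1). The
   resulting nonnegative quadratic in s has a discriminant that controls the derivative of J at x n
   in the direction v. *)
have gradient n v : (A (x n) v - F v) ^+ 2 <= n.+1%:R^-1 * A v v.
  apply: nonneg_quadratic_discr => [|s].
    by apply: le_trans (A_coercive v); rewrite mulr_ge0 ?sqr_ge0// ltW.
  have := mJ (x n + s *: v); have := xm n; rewrite /J dualD dualZ.
  rewrite !ADl !ADr !AZl !AZr (A_sym v (x n)).
  move: (A (x n) (x n)) (A v v) (A _ _) (F _) (F v) (_^-1) => *.
  lra.
exists u => v; apply/eqP; rewrite -subr_eq0 -normr_le0.
apply/ler_addgt0Pr => e e0; rewrite add0r.
have Mv0 : 0 < `|M| * `|v| + 1 by rewrite ltr_wpDl// mulr_ge0.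
have Av0 : 0 <= A v v.
  by apply: le_trans (A_coercive v); rewrite mulr_ge0 ?sqr_ge0// ltW.
have [|N1 _ hN1] := (@cvgrPdist_lt _ _ _ _ _ x u).1 xu (e / 2 / (`|M| * `|v| + 1)).
  by rewrite !divr_gt0.
have [|N2 hN2] := @invn_lt R ((e / 2) ^+ 2 / (A v v + 1)).
  by rewrite divr_gt0 ?exprn_gt0 ?divr_gt0// ltr_wpDl.
pose n := maxn N1 N2.
have h1 : `|A (u - x n) v| <= e / 2.
  apply: le_trans (A_bounded _ _) _.
  have /ltW := hN1 n (leq_maxl _ _); rewrite ler_pdivlMr// => h.
  apply: le_trans h; rewrite mulrAC mulrC ler_wpM2l//.
  by apply: (@le_trans _ _ (`|M| * `|v|)); [rewrite ler_wpM2r// ler_norm|lra].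
have h2 : `|A (x n) v - F v| <= e / 2.
  rewrite -[leRHS]gtr0_norm ?divr_gt0// -!sqrtr_sqr; apply: ler_wsqrtr.
  apply: le_trans (gradient n v) _.
  have /ltW := hN2 n (leq_maxr _ _); rewrite ler_pdivlMr ?ltr_wpDl// => h.
  apply: le_trans h; rewrite ler_wpM2l// lerDl.
  by rewrite ler01.
rewrite (_ : A u v - F v = A (u - x n) v + (A (x n) v - F v)).
  by rewrite (le_trans (ler_normD _ _))// [leRHS]splitr lerD.
by rewrite -[- x n]scaleN1r ADl AZl; ring.
Qed.

End lax_milgram.

(** * Continuous bilinear forms and their operators through the Riesz representation *)

Section cbilinear_theory.
Context {R : realType} {V W : normedModType R}.
Implicit Type b : cbilinear V W.

Lemma cbilinearDl b v v' w : b (v + v') w = b v w + b v' w.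
Proof. exact: linearDl. Qed.

Lemma cbilinearBl b v v' w : b (v - v') w = b v w - b v' w.
Proof. exact: linearBl. Qed.

Lemma cbilinearZl b (k : R) v w : b (k *: v) w = k * b v w.
Proof. exact: linearZl_LR. Qed.

Lemma cbilinearDr b v w w' : b v (w + w') = b v w + b v w'.
Proof. exact: linearDr. Qed.

Lemma cbilinearBr b v w w' : b v (w - w') = b v w - b v w'.
Proof. exact: linearBr. Qed.

Lemma cbilinearZr b (k : R) v w : b v (k *: w) = k * b v w.
Proof. exact: linearZr_LR. Qed.

Lemma cbilinear0l b w : b 0 w = 0.
Proof. exact: linear0l. Qed.

Lemma cbilinear0r b v : b v 0 = 0.
Proof. exact: linear0r. Qed.

End cbilinear_theory.

(** Continuity at the origin gives |b| < 1 on a ball of radius e. Rescaling both arguments to norm e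
    / 2 yields the constant 4 / e^2. *)
Lemma cbilinear_bounded (R : realType) (V W : normedModType R) (b : cbilinear V W) :
  exists2 M, 0 < M & forall v w, `|b v w| <= M * `|v| * `|w|.
Proof.
have := @cbilinear_continuous R V W b (0, 0).
rewrite /continuous_at/= cbilinear0r => /cvgrPdist_lt /(_ 1 ltr01) /nbhs_ballP[e /= e0 be].
exists (4 / e ^+ 2); first by rewrite divr_gt0// exprn_gt0.
move=> v w.
have [->|v0] := eqVneq v 0; first by rewrite cbilinear0l !normr0 mulr0 mul0r.
have [->|w0] := eqVneq w 0; first by rewrite cbilinear0r !normr0 mulr0.
have nv : 0 < `|v| by rewrite normr_gt0.
have nw : 0 < `|w| by rewrite normr_gt0.
have := be ((e / 2 / `|v|) *: v, (e / 2 / `|w|) *: w).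
rewrite /= sub0r normrN cbilinearZl cbilinearZr !normrM !normfV.
rewrite !(gtr0_norm e0) !(gtr0_norm nv) !(gtr0_norm nw) (@gtr0_norm _ 2)// => h.
have {}h : e / 2 / `|v| * (e / 2 / `|w| * `|b v w|) < 1.
  apply: h; split; rewrite -ball_normE /= sub0r normrN normrZ !normrM !normfV.
    by rewrite (gtr0_norm e0) normr_id (@gtr0_norm _ 2)// divfK ?gt_eqF//; lra.
  by rewrite (gtr0_norm e0) normr_id (@gtr0_norm _ 2)// divfK ?gt_eqF//; lra.
rewrite -ler_pdivrMr// -ler_pdivrMr// ler_pdivlMr ?exprn_gt0//.
have -> : `|b v w| / `|w| / `|v| * e ^+ 2 = 4 * (e / 2 / `|v| * (e / 2 / `|w| * `|b v w|)).
  by field; rewrite !gt_eqF.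
by rewrite -[leRHS]mulr1 ler_wpM2l// ltW.
Qed.

Section riesz_representation.
Context {R : realType} {V : hilbertType R}.
Implicit Types F G : dual V.

Lemma rep_subproof F : exists u : V, forall v, inner u v = F v :> R.
Proof.
apply: (@lax_milgram_sym R V inner 1 1) => //.
- by move=> k x y z; rewrite innerDl innerZl.
- exact: innerC.
- by move=> x y; rewrite mul1r inner_Cauchy_Schwarz.
- by move=> x; rewrite mul1r inner_norm.
Qed.

Definition rep F : V := projT1 (cid (rep_subproof F)).

Lemma repE F v : inner (rep F) v = F v :> R.
Proof. by rewrite /rep; case: cid. Qed.

Lemma repD F G : rep (F + G) = rep F + rep G.
Proof. by apply: inner_nondegenerate => z; rewrite innerDl !repE. Qed.

Lemma repZ (k : R) F : rep (k *: F) = k *: rep F.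
Proof. by apply: inner_nondegenerate => z; rewrite innerZl !repE. Qed.

Lemma rep_norm F : `|rep F| = `|F|.
Proof.
apply/eqP; rewrite eq_le; apply/andP; split; last first.
  by apply: dual_norm_lub => // v; rewrite -repE inner_Cauchy_Schwarz.
have [->|r0] := eqVneq (rep F) 0; first by rewrite normr0.
rewrite -(@ler_pM2r _ `|rep F|) ?normr_gt0// -expr2 -inner_norm repE.
exact: le_trans (ler_norm _) (dual_boundedP _ _).
Qed.

End riesz_representation.

Section rep_op.
Context {R : realType} {V : normedModType R} {W : hilbertType R}.
Variable b : cbilinear V W.

(** Dual-valued operators are moved into the Hilbert space, so that norms are computed with inner
    products and the values can serve as test vectors, as in [rep_op_a_sqr_le]. *)
Definition rep_op (v : V) : W := rep (form_op b v).

Lemma rep_opE v w : inner (rep_op v) w = b v w :> R.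
Proof. by rewrite repE. Qed.

Lemma rep_opD v v' : rep_op (v + v') = rep_op v + rep_op v'.
Proof.
by apply: inner_nondegenerate => z; rewrite innerDl !rep_opE cbilinearDl.
Qed.

Lemma rep_opZ (k : R) v : rep_op (k *: v) = k *: rep_op v.
Proof.
by apply: inner_nondegenerate => z; rewrite innerZl !rep_opE cbilinearZl.
Qed.

Lemma rep_op_bounded (M : R) : 0 <= M -> (forall v w, `|b v w| <= M * `|v| * `|w|) ->
  forall v, `|rep_op v| <= M * `|v|.
Proof.
move=> M0 bM v; rewrite rep_norm; apply: dual_norm_lub; first exact: mulr_ge0.
by move=> w; exact: bM.
Qed.

End rep_op.

(** Energy inequalities are quadratic in the unknown norm y, with a mixed term S y; this makes them
    linear in the data S. If y > (K + 1) S, then y^2 > (K + 1) S y, and the hypothesis leaves S y <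
    K S^2, against S y >= (K + 1) S^2. *)
Lemma le_of_sqr_le (R : realFieldType) (K S y : R) : 0 <= K -> 0 <= S -> 0 <= y ->
  y ^+ 2 <= K * (S ^+ 2 + S * y) -> y <= (K + 1) * S.
Proof.
move=> K0 S0 y0 h; rewrite leNgt; apply/negP => hy.
have h1 : (K + 1) * S * y < y * y by rewrite ltr_pM2r//; apply: le_lt_trans hy; rewrite mulr_ge0// addr_ge0.
have h2 : S * ((K + 1) * S) <= S * y by rewrite ler_wpM2l// ltW.
have h3 : 0 <= S * S by rewrite mulr_ge0.
by nra.
Qed.

(** * The stationary saddle point problem: solvability and bounds *)

Section saddle_point.
Context {R : realType} {V Q : hilbertType R}.
Variables (a : cbilinear V V) (b : cbilinear V Q) (alpha beta M : R).
Hypothesis a_sym : forall w v, a w v = a v w.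
Hypothesis a_ge0 : forall v, 0 <= a v v.
Hypothesis alpha_gt0 : 0 < alpha.
Hypothesis a_coercive : forall v, (forall q, b v q = 0) -> alpha * `|v| ^+ 2 <= a v v.
Hypothesis beta_gt0 : 0 < beta.
Hypothesis b_inf_sup : inf_sup b beta.
Hypothesis M_gt0 : 0 < M.
Hypothesis a_bounded : forall v w, `|a v w| <= M * `|v| * `|w|.

Local Notation A := (rep_op a).
Local Notation B := (rep_op b).
Local Notation Bt := (rep_op (flip b)).

Lemma rep_op_flipE q v : inner (Bt q) v = b v q :> R.
Proof. by rewrite rep_opE. Qed.

Lemma inf_sup_rep_op q : beta * `|q| <= `|Bt q|.
Proof.
apply: le_trans (b_inf_sup q) _.
have [->|/set0P S0] := eqVneq [set b v q / `|v| | v in [set v : V | v != 0]] set0.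
  by rewrite sup0.
apply: ge_sup => // _ [v /= v0 <-].
rewrite ler_pdivrMr ?normr_gt0// -rep_op_flipE.
exact: le_trans (ler_norm _) (inner_Cauchy_Schwarz _ _).
Qed.

(** The lift is sought as v = B^* p. The equation becomes (B^* p, B^* q) = (G, q), a symmetric
    problem in Q that the inf-sup condition makes coercive with constant beta^2. Then |v|^2 = (G, p)
    <= |G| |v| / beta. *)
Lemma inf_sup_lift (G : Q) :
  exists2 v : V, (forall q, b v q = inner G q) & `|v| <= `|G| / beta.
Proof.
have [N N0 bN] := cbilinear_bounded (flip b).
have BtN q : `|Bt q| <= N * `|q| by apply: rep_op_bounded => //; exact: ltW.
have [|||||p hp] := @lax_milgram_sym R Q (fun p q => inner (Bt p) (Bt q))
    (N ^+ 2) (beta ^+ 2) _ _ _ _ _ (riesz G).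
- by move=> k x y z; rewrite rep_opD rep_opZ innerDl innerZl.
- by move=> x y; rewrite innerC.
- move=> x y; apply: le_trans (inner_Cauchy_Schwarz _ _) _.
  by rewrite expr2 -mulrA mulrACA ler_pM.
- exact: exprn_gt0.
- move=> x; rewrite inner_norm -exprMn ler_sqr ?nnegrE//.
    exact: inf_sup_rep_op.
  by rewrite mulr_ge0// ltW.
have {}hp q : inner (Bt p) (Bt q) = inner G q :> R by exact: hp.
exists (Bt p) => [q|]; first by rewrite -rep_op_flipE innerC hp.
have [->|v0] := eqVneq (Bt p) 0; first by rewrite normr0 divr_ge0// ltW.
rewrite ler_pdivlMr// -(@ler_pM2r _ `|Bt p|) ?normr_gt0//.
rewrite mulrAC -expr2 -inner_norm hp.
apply: (@le_trans _ _ (`|G| * `|p| * beta)).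
  rewrite ler_wpM2r ?(ltW beta_gt0)//.
  exact: le_trans (ler_norm _) (inner_Cauchy_Schwarz _ _).
by rewrite -mulrA ler_wpM2l// mulrC inf_sup_rep_op.
Qed.

Lemma a_kernel_part v w : (forall q, b w q = b v q) ->
  alpha * `|v - w| ^+ 2 <= a (v - w) (v - w).
Proof. by move=> wv; apply: a_coercive => q; rewrite cbilinearBl wv subrr. Qed.

Lemma a_diag_le v : a v v <= M * `|v| ^+ 2.
Proof. by rewrite expr2 mulrA; exact: le_trans (ler_norm _) (a_bounded _ _). Qed.

(** Makes the form left after eliminating p coercive. With w the lift of B v, v - w lies in the
    kernel of B, where a is coercive; a (v - w) (v - w) <= 2 a v v + 2 a w w because a (v + w) (v +
    w) >= 0; and |w| <= |B v| / beta. *)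
Lemma penalised_form_coercive : exists2 C, 0 < C &
  forall v, `|v| ^+ 2 <= C * (a v v + `|B v| ^+ 2).
Proof.
exists (4 / alpha + (4 * M / alpha + 2) / beta ^+ 2).
  by rewrite addr_gt0// divr_gt0 ?exprn_gt0// addr_gt0// divr_gt0// mulr_gt0.
move=> v; have [w bw wB] := inf_sup_lift (B v).
have /a_kernel_part h1 : forall q, b w q = b v q by move=> q; rewrite bw rep_opE.
have h2 : `|w| ^+ 2 <= `|B v| ^+ 2 / beta ^+ 2.
  by rewrite -expr_div_n ler_sqr ?nnegrE// divr_ge0// ltW.
have h3 := a_ge0 (v + w).
have h4 := a_diag_le w.
have h5 : `|v| ^+ 2 <= 2 * `|v - w| ^+ 2 + 2 * `|w| ^+ 2.
  have := sqr_ge0 `|v - w - w|; rewrite -!inner_norm !innerBl !innerBr.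
  by rewrite (innerC w v); lra.
have h6 : alpha * `|v - w| ^+ 2 <= 2 * a v v + 2 * M * `|w| ^+ 2.
  move: h1 h3; rewrite !cbilinearBl !cbilinearBr !cbilinearDl !cbilinearDr (a_sym w v).
  lra.
have h7 : `|v| ^+ 2 <= (4 * a v v + 4 * M * `|w| ^+ 2) / alpha + 2 * `|w| ^+ 2.
  apply: le_trans h5 _; rewrite lerD2r ler_pdivlMr//.
  lra.
apply: le_trans h7 _.
have -> : (4 * a v v + 4 * M * `|w| ^+ 2) / alpha + 2 * `|w| ^+ 2 =
  4 / alpha * a v v + (4 * M / alpha + 2) * `|w| ^+ 2 by field; rewrite gt_eqF.
have K0 : 0 <= 4 * M / alpha + 2 by rewrite addr_ge0// divr_ge0 ?mulr_ge0// ltW.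
have h8 : (4 * M / alpha + 2) * `|w| ^+ 2 <= (4 * M / alpha + 2) * (`|B v| ^+ 2 / beta ^+ 2).
  exact: ler_wpM2l.
apply: le_trans (lerD (lexx _) h8) _.
rewrite -subr_ge0 (_ : _ - _ =
  4 / alpha * `|B v| ^+ 2 + (4 * M / alpha + 2) / beta ^+ 2 * a v v); last by ring.
rewrite addr_ge0// mulr_ge0 ?sqr_ge0 ?divr_ge0//; first exact: ltW.
by rewrite exprn_ge0// ltW.
Qed.

Definition saddle (l : R) (F : V) (G : Q) (u : V) (p : Q) : Prop :=
  (forall v, a u v + b v p = inner F v) /\
  (forall q, b u q - l * inner p q = inner G q).

Lemma saddle_exists (l : R) (F : V) (G : Q) : 0 < l ->
  exists up : V * Q, saddle l F G up.1 up.2.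
Proof.
move=> l0; have [C C0 hC] := penalised_form_coercive.
have [N N0 bN] := cbilinear_bounded b.
have BN v : `|B v| <= N * `|v| by apply: rep_op_bounded => //; exact: ltW.
(* Substituting p = l^-1 (B u - G) into the first equation gives this form and this right-hand side.
   The minimum in the coercivity constant accounts for the weight l^-1 of |B v|^2. *)
have [|||||u hu] := @lax_milgram_sym R V
    (fun u v => a u v + l^-1 * inner (B u) (B v)) (M + l^-1 * N ^+ 2)
    (Num.min 1 l^-1 / C) _ _ _ _ _ (riesz (F + l^-1 *: Bt G)).
- move=> k x y z; rewrite cbilinearDl cbilinearZl rep_opD rep_opZ innerDl innerZl.
  by ring.
- by move=> x y; rewrite a_sym innerC.
- move=> x y; apply: le_trans (ler_normD _ _) _; rewrite !mulrDl lerD//.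
  rewrite normrM gtr0_norm ?invr_gt0// -!mulrA ler_wpM2l ?invr_ge0 ?(ltW l0)//.
  apply: le_trans (inner_Cauchy_Schwarz _ _) _.
  apply: le_trans (ler_pM _ _ (BN x) (BN y)) _ => //.
  by rewrite le_eqVlt; apply/orP; left; apply/eqP; ring.
- by rewrite divr_gt0// lt_min ltr01 invr_gt0.
- move=> x; rewrite mulrAC ler_pdivrMr//.
  have min0 : 0 <= Num.min 1 l^-1 by rewrite le_min ler01 invr_ge0 ltW.
  apply: le_trans (ler_wpM2l min0 (hC x)) _.
  rewrite mulrCA mulrC ler_wpM2r ?(ltW C0)// mulrDr inner_norm lerD//.
    by rewrite ler_piMl// ge_min lexx.
  by rewrite ler_wpM2r ?sqr_ge0// ge_min lexx orbT.
exists (u, l^-1 *: (B u - G)); split => /= [v|q]; last first.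
  by rewrite innerZl innerBl rep_opE mulrA divff ?gt_eqF// mul1r subKr.
have : a u v + l^-1 * inner (B u) (B v) = inner (F + l^-1 *: Bt G) v by exact: hu.
rewrite innerDl innerZl rep_op_flipE => hv.
rewrite cbilinearZr cbilinearBr.
move: hv; rewrite (innerC (B u)) rep_opE -[b v (B u)]/(b v (B u)); lra.
Qed.

Lemma a_Cauchy_Schwarz u v : (a u v) ^+ 2 <= a u u * a v v.
Proof.
apply: nonneg_quadratic_discr => // s.
have := a_ge0 (u + s *: v); rewrite cbilinearDl !cbilinearDr !cbilinearZl !cbilinearZr.
by rewrite (a_sym v u); lra.
Qed.

(** The Cauchy-Schwarz inequality of a, tested with v = A u, gives |A u|^4 <= a u u * a (A u) (A u)
    <= a u u * M |A u|^2. *)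
Lemma rep_op_a_sqr_le u : `|A u| ^+ 2 <= M * a u u.
Proof.
have [->|w0] := eqVneq (A u) 0; first by rewrite normr0 expr0n mulr_ge0// ltW.
have nw : 0 < `|A u| ^+ 2 by rewrite exprn_gt0// normr_gt0.
rewrite -(ler_pM2r nw) -expr2 -{1}inner_norm rep_opE.
apply: le_trans (a_Cauchy_Schwarz _ _) _; rewrite mulrAC mulrC ler_wpM2r//.
exact: a_diag_le.
Qed.

(** B u equals G + l p, so its lift w is bounded by |G| + l |p|. The remainder u - w lies in the
    kernel of B; testing with it removes p from the first equation and leaves only F and A w. The
    constant is made at least 1 so that c |F| dominates |F| later. *)
Lemma saddle_primal_bound : exists2 c, 1 <= c &
  forall l F G u p, 0 < l -> saddle l F G u p ->
    `|u| <= c * (`|F| + `|G| + l * `|p|).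
Proof.
pose c0 := 1 / alpha + (M / alpha + 1) / beta.
exists (c0 + 1); first by rewrite lerDr /c0 addr_ge0// divr_ge0 ?addr_ge0 ?divr_ge0// ltW.
move=> l F G u p l0 [h1 h2].
have BuE : B u = G + l *: p.
  apply: inner_nondegenerate => q; rewrite rep_opE innerDl innerZl -h2; ring.
have [w bw wB] := inf_sup_lift (B u).
have wu q : b w q = b u q by rewrite bw rep_opE.
have {}wB : `|w| <= (`|G| + l * `|p|) / beta.
  apply: le_trans wB _; rewrite ler_wpM2r ?invr_ge0 ?(ltW beta_gt0)// BuE.
  by apply: le_trans (ler_normD _ _) _; rewrite normrZ gtr0_norm.
have hK : `|u - w| <= (`|F| + M * `|w|) / alpha.
  have [->|uw0] := eqVneq (u - w) 0.
    by rewrite normr0 divr_ge0 ?addr_ge0 ?mulr_ge0// ltW.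
  have nuw : 0 < `|u - w| by rewrite normr_gt0.
  rewrite ler_pdivlMr// -(ler_pM2r nuw) mulrAC -expr2 mulrC.
  apply: le_trans (a_kernel_part wu) _; rewrite cbilinearBl.
  have -> : a u (u - w) = inner F (u - w).
    by rewrite -h1 cbilinearBl -wu subrr addr0.
  apply: le_trans (ler_norm _) (le_trans (ler_normB _ _) _).
  by rewrite mulrDl lerD// inner_Cauchy_Schwarz.
have -> : u = (u - w) + w by rewrite subrK.
apply: le_trans (ler_normD _ _) (le_trans (lerD hK (lexx _)) _).
rewrite (_ : _ / alpha + _ = 1 / alpha * `|F| + (M / alpha + 1) * `|w|); last first.
  by field; rewrite gt_eqF.
have K0 : 0 <= M / alpha + 1 by rewrite addr_ge0// divr_ge0// ltW.
apply: le_trans (lerD (lexx _) (ler_wpM2l K0 wB)) _.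
rewrite /c0; set x := l * _.
have x0 : 0 <= x by rewrite mulr_ge0// ltW.
have i1 : 0 <= 1 / alpha * (`|G| + x) by rewrite mulr_ge0 ?addr_ge0 ?divr_ge0// ltW.
have i2 : 0 <= (M / alpha + 1) / beta * `|F| by rewrite mulr_ge0 ?divr_ge0// ltW.
have i3 : 0 <= `|F| + `|G| + x by rewrite !addr_ge0.
rewrite -subr_ge0 (_ : _ - _ = 1 / alpha * (`|G| + x) + (M / alpha + 1) / beta * `|F| + (`|F| + `|G| + x)).
  by rewrite !addr_ge0.
by ring.
Qed.

(* The energy identity, with the primal bound inserted. *)
Lemma saddle_energy_bound : exists2 c, 1 <= c &
  forall l F G u p, 0 < l -> saddle l F G u p ->
    `|u| <= c * (`|F| + `|G| + l * `|p|) /\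
    a u u + l * `|p| ^+ 2 <= c * `|F| * (`|F| + `|G| + l * `|p|) + `|G| * `|p|.
Proof.
have [c c1 hc] := saddle_primal_bound; exists c => // l F G u p l0 h.
have hu := hc _ _ _ _ _ l0 h; split=> //; case: h => h1 h2.
have -> : a u u + l * `|p| ^+ 2 = inner F u - inner G p.
  by rewrite -h1 -h2 inner_norm; ring.
apply: le_trans (ler_norm _) (le_trans (ler_normB _ _) _).
apply: lerD (inner_Cauchy_Schwarz _ _).
apply: le_trans (inner_Cauchy_Schwarz _ _) _.
by rewrite (mulrC c) -mulrA ler_wpM2l.
Qed.

(** For l >= 1 the term l |p|^2 of the energy dominates, and division by l gives a bound free of l.
    For l <= 1 that term may degenerate; instead beta |p| <= |B^* p| = |F - A u|, where |A u|^2 <= M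
    a u u is bounded by the energy and l |p| <= |p|. Both cases end with an inequality quadratic in
    |p|. *)
Lemma saddle_dual_bound : exists2 C, 0 < C &
  forall l F G u p, 0 < l -> saddle l F G u p -> `|p| <= C * (`|F| + `|G|).
Proof.
have [c c1 hc] := saddle_energy_bound.
have c0 : 0 <= c by rewrite (le_trans ler01).
pose K := (2 + 2 * M) / beta ^+ 2.
have K0 : 0 <= K by rewrite divr_ge0 ?sqr_ge0 ?addr_ge0 ?mulr_ge0// ltW.
exists ((K + 2) * c); first by apply: mulr_gt0; [apply: ltr_wpDl|apply: lt_le_trans c1].
move=> l F G u p l0 h; have [_ hX] := hc _ _ _ _ _ l0 h.
(* S is such that c |F| (|F| + |G|) <= S^2 and that, for l <= 1, the coefficient of |p| on the right
   of the energy bound is at most S. *)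
pose S := c * `|F| + `|G|.
have S0 : 0 <= S by rewrite addr_ge0// mulr_ge0.
have fS : `|F| <= S.
  by rewrite (@le_trans _ _ (c * `|F|))// ?ler_peMl// lerDl.
have S2 : c * `|F| * (`|F| + `|G|) <= S ^+ 2.
  rewrite expr2; apply: ler_pM; rewrite ?mulr_ge0 ?addr_ge0// /S ?lerDl// lerD2r.
  by rewrite ler_peMl.
suff hS : `|p| <= (K + 2) * S.
  apply: le_trans hS _; rewrite -mulrA ler_wpM2l ?addr_ge0// /S mulrDr lerD2l.
  by rewrite ler_peMl.
have [l1|/ltW l1] := leP 1 l.
  apply: (@le_trans _ _ ((1 + 1) * S)); last by rewrite ler_wpM2r//; lra.
  apply: le_of_sqr_le => //; rewrite mul1r -(ler_pM2l l0).
  have := a_ge0 u.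
  have : 0 <= (l - 1) * (c * `|F| * (`|F| + `|G|) + `|G| * `|p|).
    by rewrite mulr_ge0 ?subr_ge0 ?addr_ge0 ?mulr_ge0 ?addr_ge0.
  have := ler_wpM2l (ltW l0) S2.
  rewrite /S; move: hX; nra.
apply: (@le_trans _ _ ((K + 1) * S)); last by rewrite ler_wpM2r//; lra.
apply: le_of_sqr_le => //.
have hB : beta ^+ 2 * `|p| ^+ 2 <= 2 * `|F| ^+ 2 + 2 * (M * a u u).
  rewrite -exprMn; apply: (@le_trans _ _ (`|Bt p| ^+ 2)).
    by rewrite ler_sqr ?nnegrE ?inf_sup_rep_op// mulr_ge0// ltW.
  have -> : Bt p = F - A u.
    apply: inner_nondegenerate => v; rewrite rep_op_flipE innerBl rep_opE.
    by case: h => h1 _; rewrite -h1; ring.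
  have := sqr_ge0 `|F + A u|; have := rep_op_a_sqr_le u.
  rewrite -!inner_norm !innerBl !innerBr !innerDl !innerDr (innerC (A u) F).
  lra.
rewrite /K mulrAC ler_pdivlMr ?exprn_gt0// mulrC.
apply: le_trans hB _.
have hX' : a u u <= S ^+ 2 + S * `|p|.
  have : 0 <= l * `|p| ^+ 2 by rewrite mulr_ge0 ?sqr_ge0// ltW.
  have : 0 <= (1 - l) * (c * `|F| * `|p|) by rewrite mulr_ge0 ?subr_ge0// !mulr_ge0.
  move: hX S2; rewrite /S; nra.
have := ler_wpM2l (ltW M_gt0) hX'.
have : `|F| ^+ 2 <= S ^+ 2 by rewrite ler_sqr ?nnegrE.
have : 0 <= S * `|p| by rewrite mulr_ge0.
lra.
Qed.

(** Multiplied by l, the energy inequality is quadratic in x = l |p|, and the factor l remains on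
    |F| only. So P = c L + 1 weighs |F| alone, and x <= 2 (P |F| + |G|). Inserted in the primal
    bound, this gives the coefficient c (1 + 2 P) for |F| and 3 c, free of L, for |G|. *)
Lemma saddle_primal_bound_uniform : exists2 C, 0 < C & forall L, 0 < L ->
  exists2 C1, 0 < C1 & forall l F G u p, 0 < l -> l <= L -> saddle l F G u p ->
    `|u| <= C1 * `|F| + C * `|G|.
Proof.
have [c c1 hc] := saddle_energy_bound.
have c0 : 0 < c by rewrite (lt_le_trans ltr01).
exists (3 * c) => [|L L0]; first by rewrite mulr_gt0.
pose P := c * L + 1; have P0 : 0 < P by rewrite addr_gt0// mulr_gt0.
have P1 : 1 <= P by rewrite lerDr mulr_ge0// ltW.
exists (c * (1 + 2 * P)); first by rewrite mulr_gt0// addr_gt0// mulr_gt0.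
move=> l F G u p l0 lL h; have [hu hX] := hc _ _ _ _ _ l0 h.
have x0 : 0 <= l * `|p| by rewrite mulr_ge0// ltW.
pose S := P * `|F| + `|G|.
have S0 : 0 <= S by rewrite addr_ge0// mulr_ge0// ltW.
have S2 : P * `|F| * (`|F| + `|G|) <= S ^+ 2.
  rewrite expr2; apply: ler_pM; rewrite ?mulr_ge0 ?addr_ge0// /S ?lerDl// ?lerD2r ?ler_peMl//.
  by rewrite mulr_ge0// ltW.
have hx : l * `|p| <= (1 + 1) * S.
  apply: le_of_sqr_le => //; rewrite mul1r.
  have : 0 <= l * a u u by rewrite mulr_ge0// ltW.
  have := ler_wpM2l (ltW l0) hX.
  have : l * (c * `|F| * (`|F| + `|G| + l * `|p|)) <= P * `|F| * (`|F| + `|G| + l * `|p|).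
    rewrite !mulrA ler_wpM2r ?addr_ge0// ler_wpM2r// /P (mulrC l).
    have := ler_wpM2l (ltW c0) lL; lra.
  have E : l * (a u u + l * `|p| ^+ 2) = l * a u u + (l * `|p|) ^+ 2 by ring.
  rewrite E; move: S2; rewrite /S.
  move: (l * a u u) => X.
  rewrite (mulrDr l) (_ : l * (`|G| * `|p|) = `|G| * (l * `|p|)); last by ring.
  move: (l * `|p|) (l * _) => x Z; nra.
apply: le_trans hu _.
have := ler_wpM2l (ltW c0) hx; rewrite /S; nra.
Qed.

End saddle_point.

Lemma lipschitz_continuous (R : realType) (B C : normedModType R) (phi : B -> C) (c : R) :
  (forall x y, `|phi x - phi y| <= c * `|x - y|) -> continuous phi.
Proof.
move=> hc x; apply/cvgrPdist_le => e e0.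
have c0 : 0 < `|c| + 1 by rewrite ltr_wpDl.
near=> y; apply: le_trans (hc x y) _.
have h : `|x - y| <= e / (`|c| + 1).
  by near: y; apply: cvgr_dist_le (divr_gt0 e0 c0); exact: cvg_id.
rewrite ler_pdivlMr// mulrC in h; apply: le_trans h.
by rewrite ler_wpM2r// (le_trans (ler_norm c))// lerDl.
Unshelve. all: by end_near.
Qed.

(** * Finitely valued functions, their limits and strong measurability *)

Section simple_limits.
Context {R : realType}.
Implicit Types (B C E : normedModType R) (D : set R).
Local Notation mu := (@lebesgue_measure R).

(** A version of [simple_fun] that is independent of the domain of integration and stable under
    pairing and under composition with arbitrary maps. *)
Definition finitely_valued B (s : R -> B) : Prop :=
  finite_set (range s) /\ forall y, measurable (s @^-1` [set y]).

Lemma finitely_valued_preimage B (s : R -> B) (X : set B) :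
  finitely_valued s -> measurable (s @^-1` X).
Proof.
move=> [fs ms].
rewrite (_ : s @^-1` X = \bigcup_(y in range s `&` X) s @^-1` [set y]).
  apply: fin_bigcup_measurable => [|y _]; last exact: ms.
  by apply: sub_finite_set fs => y [].
apply/seteqP; split=> [t Xt|t [y [_ Xy] /= ->]] //.
by exists (s t) => //; split => //; exists t.
Qed.

Lemma finitely_valued_comp B C (phi : B -> C) (s : R -> B) :
  finitely_valued s -> finitely_valued (phi \o s).
Proof.
move=> fs; split=> [|y]; last exact: (finitely_valued_preimage (phi @^-1` [set y])).
by rewrite -(image_comp s phi); apply: finite_image; exact: fs.1.
Qed.

Lemma finitely_valued_pair B C (s : R -> B) (s' : R -> C) :
  finitely_valued s -> finitely_valued s' ->
  finitely_valued (fun t => (s t, s' t) : B * C).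
Proof.
move=> [fs ms] [fs' ms']; split=> [|[y y']].
  apply: (@sub_finite_set _ _ (range s `*` range s')); last exact: finite_setX.
  by move=> _ [t _ <-]; split; exists t.
rewrite (_ : _ @^-1` _ = s @^-1` [set y] `&` s' @^-1` [set y']); first exact: measurableI.
by apply/seteqP; split=> t /= [-> ->].
Qed.

Lemma finitely_valued_indic D : measurable D -> finitely_valued (\1_D : R -> R^o).
Proof.
move=> mD; split=> [|z].
  apply: (@sub_finite_set _ _ [set 0; 1]); last exact: finite_set2.
  exact: image_indic_sub.
by rewrite preimage_indic; case: ifP => _; case: ifP => _ //; exact: measurableC.
Qed.

Lemma finitely_valued_restrict B D (s : R -> B) : measurable D ->
  finitely_valued s -> finitely_valued (patch (cst 0) D s).
Proof.
move=> mD fs; rewrite (_ : patch _ _ _ = (fun z : B * R^o => z.2 *: z.1) \o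
  (fun t => (s t, \1_D t))).
  by apply: finitely_valued_comp; apply: finitely_valued_pair => //;
    exact: finitely_valued_indic.
apply/funext => t; rewrite /patch /= indicE.
by case: ifP; rewrite ?scale1r ?scale0r.
Qed.

(* Pointwise everywhere limits of finitely valued Borel functions.  Unlike
   [strongly_measurable], which only asks for almost everywhere convergence,
   these functions are Borel. *)
Definition simple_limit B (f : R -> B) : Prop :=
  exists s : nat -> R -> B, (forall n, finitely_valued (s n)) /\
    forall t, s n t @[n --> \oo] --> f t.

Lemma simple_limit_comp B C (phi : B -> C) (f : R -> B) :
  continuous phi -> simple_limit f -> simple_limit (phi \o f).
Proof.
move=> cphi [s [fs sf]]; exists (fun n => phi \o s n); split=> [n|t].
  exact: finitely_valued_comp.
exact: (continuous_cvg _ (cphi _) (sf t)).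
Qed.

Lemma simple_limit_pair B C (f : R -> B) (g : R -> C) :
  simple_limit f -> simple_limit g -> simple_limit (fun t => (f t, g t) : B * C).
Proof.
move=> [s [fs sf]] [s' [fs' sg]]; exists (fun n t => (s n t, s' n t)); split=> [n|t].
  exact: finitely_valued_pair.
exact: cvg_pair.
Qed.

Lemma simple_limit_comp2 B C E (phi : B * C -> E) (f : R -> B) (g : R -> C) :
  continuous phi -> simple_limit f -> simple_limit g ->
  simple_limit (fun t => phi (f t, g t)).
Proof.
by move=> cphi lf lg; exact: (simple_limit_comp cphi (simple_limit_pair lf lg)).
Qed.

Lemma simple_limitD B (f g : R -> B) : simple_limit f -> simple_limit g ->
  simple_limit (fun t => f t + g t).
Proof.
by apply: (@simple_limit_comp2 B B B (fun z => z.1 + z.2)); exact: add_continuous.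
Qed.

Lemma simple_limitZ B (k : R -> R) (f : R -> B) :
  simple_limit (k : R -> R^o) -> simple_limit f -> simple_limit (fun t => k t *: f t).
Proof.
by apply: (@simple_limit_comp2 R^o B B (fun z => z.1 *: z.2)); exact: scale_continuous.
Qed.

Lemma simple_limit_measurable (f : R -> R) :
  simple_limit (f : R -> R^o) -> measurable_fun setT f.
Proof.
move=> [s [fs sf]]; apply: (@measurable_fun_cvg _ _ _ _ s) => [m _ Y mY|t _]; last exact: sf.
by rewrite setTI; exact: finitely_valued_preimage.
Qed.

Import HBSimple.

Lemma measurable_simple_limit (f : R -> R) :
  measurable_fun setT f -> simple_limit (f : R -> R^o).
Proof.
move=> mf; have [g hg] := @approximation_sfun _ _ R (EFin \o f) setT measurableT
  ((measurable_EFinP _ _).2 mf).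
exists g; split=> [n|t]; last by have /fine_cvgP[] := hg t I.
split=> [|y]; first exact: fimfunP.
by rewrite -[_ @^-1` _]setTI; exact: (measurable_funPT (g n)).
Qed.

Lemma continuous_simple_limit B (z : R -> B) : continuous z -> simple_limit z.
Proof.
move=> cz; apply: (simple_limit_comp (f := id : R -> R^o) cz).
exact: measurable_simple_limit.
Qed.


Lemma simple_limit_norm B (f : R -> B) :
  simple_limit f -> measurable_fun setT (fun t => `|f t|).
Proof.
move=> lf; apply: simple_limit_measurable.
by apply: (@simple_limit_comp B R^o (fun x => `|x|) f) => //; exact: norm_continuous.
Qed.

Lemma finitely_valued_simple_limit B (s : R -> B) : finitely_valued s -> simple_limit s.
Proof. by move=> fs; exists (fun=> s); split => // t; exact: cvg_cst. Qed.

Lemma simple_limitB B (f g : R -> B) : simple_limit f -> simple_limit g ->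
  simple_limit (fun t => f t - g t).
Proof.
move=> lf lg; apply: simple_limitD => //.
by apply: (@simple_limit_comp B B (fun x => - x) g) => //; exact: opp_continuous.
Qed.

(** Setting s n to 0 where its norm exceeds 2 |h| prepares dominated convergence. Where h t is
    nonzero, |h t - s n t| <= |h t| eventually, so the truncation becomes inactive; where h t = 0
    the truncated values are all 0. *)
Lemma dominated_approximation B (h : R -> B) : simple_limit h ->
  exists s : nat -> R -> B, [/\ forall n, finitely_valued (s n),
    forall n t, `|s n t| <= 2 * `|h t| & forall t, s n t @[n --> \oo] --> h t].
Proof.
move=> lh; have [s [fs sh]] := lh.
pose X n := [set t | `|s n t| - 2 * `|h t| <= 0].
have mX n : measurable (X n).
  have mf : measurable_fun setT (fun t => `|s n t| - 2 * `|h t|).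
    apply: measurable_funB.
      by apply: simple_limit_norm; exact: finitely_valued_simple_limit.
    by apply: measurable_funM; [exact: measurable_cst|exact: simple_limit_norm].
  rewrite (_ : X n = setT `&` (fun t => `|s n t| - 2 * `|h t|) @^-1` `]-oo, 0]).
    by apply: mf => //; exact: measurable_itv.
  by rewrite setTI; apply/seteqP; split => t; rewrite /X /= in_itv.
exists (fun n => patch (cst 0) (X n) (s n)); split=> [n|n t|t].
- exact: finitely_valued_restrict.
- rewrite /patch; case: ifP => [|_]; last by rewrite normr0 mulr_ge0.
  by rewrite inE /X /= subr_le0.
have [h0|h0] := eqVneq (h t) 0.
  rewrite h0 (_ : (fun n => _) = cst 0); first exact: cvg_cst.
  apply/funext => n; rewrite /patch; case: ifP => //.
  by rewrite inE /X /= h0 normr0 mulr0 subr0 normr_le0 => /eqP.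
apply/cvgrPdist_le => e e0.
near=> n.
have h1 : `|h t - s n t| <= e by near: n; exact: cvgr_dist_le (sh t) _ e0.
have h2 : `|h t - s n t| <= `|h t|.
  by near: n; apply: cvgr_dist_le (sh t) _ _; rewrite normr_gt0.
rewrite /patch ifT// inE /X /= subr_le0.
rewrite (_ : s n t = h t - (h t - s n t)); last by rewrite subKr.
by apply: le_trans (ler_normB _ _) _; rewrite mulr2n mulrDl mul1r lerD2l.
Unshelve. all: by end_near.
Qed.

(** The exceptional set lies in a measurable null set N. The function and its approximations are set
    to 0 on N and outside D, and convergence then holds everywhere. *)
Lemma strongly_measurable_simple_limit B D (f : R -> B) : measurable D ->
  strongly_measurable D f -> exists f' : R -> B, [/\ simple_limit f',
    forall t, ~ D t -> f' t = 0 & {ae mu, forall t, D t -> f' t = f t}].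
Proof.
move=> mD [s [ss [N [mN N0 sN]]]].
have fs n : finitely_valued (s n) by case: (ss n).
exists (patch (cst 0) (D `\` N) f); split.
- exists (fun n => patch (cst 0) (D `\` N) (s n)); split=> [n|t].
    by apply: finitely_valued_restrict => //; exact: measurableD.
  rewrite /patch; case: ifPn => [|_]; last exact: cvg_cst.
  rewrite inE => -[Dt Nt]; apply: contrapT => h; apply: Nt; apply: sN => /= h'.
  by apply: h; exact: h'.
- by move=> t Dt; rewrite /patch ifN// notin_setE => -[].
- exists N; split => // t /= h; apply: contrapT => Nt; apply: h => Dt.
  by rewrite /patch ifT// inE.
Qed.

Lemma simple_limit_strongly_measurable B D (f : R -> B) : measurable D ->
  (mu D < +oo)%E -> simple_limit f -> strongly_measurable D f.
Proof.
move=> mD Doo [s [fs sf]]; exists s; split=> [n|]; last exact: aeW.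
case: (fs n) => f1 f2; split => // y _.
apply: le_lt_trans Doo; apply: le_measure; rewrite ?inE//.
by apply: measurableI => //; exact: f2.
Qed.

(* No measurability is assumed: the library integral of a nonnegative function
   is the supremum over the simple functions below it. *)
Lemma le_integral_nonmeasurable D (f1 f2 : R -> \bar R) :
  (forall t, D t -> (0 <= f1 t)%E) -> (forall t, D t -> (f1 t <= f2 t)%E) ->
  (\int[mu]_(t in D) f1 t <= \int[mu]_(t in D) f2 t)%E.
Proof.
move=> f10 f12.
rewrite !ge0_integralE//; last first.
  by move=> t Dt; exact: (le_trans (f10 t Dt) (f12 t Dt)).
apply: ereal_sup_le => _ [h hf <-]; exists h => // t.
apply: le_trans (hf t) _; rewrite !patchE; case: ifP => //.
by rewrite inE => Dt; exact: f12.
Qed.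

(** As f may be nonmeasurable, the null set N is handled on the side of g: adding [+oo] on N makes g
    dominate f everywhere on D and leaves its integral unchanged. *)
Lemma le_integral_ae_measurable D (f g : R -> \bar R) : measurable D ->
  (forall t, D t -> (0 <= f t)%E) -> (forall t, D t -> (0 <= g t)%E) ->
  measurable_fun D g -> {ae mu, forall t, D t -> (f t <= g t)%E} ->
  (\int[mu]_(t in D) f t <= \int[mu]_(t in D) g t)%E.
Proof.
move=> mD f0 g0 mg [N [mN N0 fN]].
apply: (@le_trans _ _ (\int[mu]_(t in D) (g t + (+oo * (\1_N t)%:E)))%E).
  apply: le_integral_nonmeasurable => // t Dt.
  rewrite indicE; case: (boolP (t \in N)) => [_|].
    by rewrite mule1 addey ?leey// gt_eqF// (lt_le_trans _ (g0 t Dt)).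
  rewrite notin_setE mule0 adde0 => Nt; apply: contrapT => h; apply: Nt.
  by apply: fN => /= h'; apply: h; exact: h'.
have mN' : measurable_fun D (fun t => +oo * (\1_N t)%:E : \bar R)%E.
  apply: emeasurable_funM; first exact: measurable_cst.
  by apply/measurable_EFinP; exact: measurable_indic.
rewrite (@ae_eq_integral _ _ _ mu D g)//; first exact: emeasurable_funD.
exists N; split => // t /= h; apply: contrapT => Nt; apply: h => Dt.
by rewrite indicE memNset// mule0 adde0.
Qed.

End simple_limits.

Lemma dual_of_bounded (R : realType) (V : normedModType R) (F : V -> R) (c : R) :
  (forall k x y, F (k *: x + y) = k * F x + F y) ->
  (forall x, `|F x| <= c * `|x|) -> exists f : dual V, forall x, f x = F x.
Proof.
move=> lF bF; have Fd : (F : V -> R^o) \in dual_pred.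
  apply/asboolP; split; first exact: lF.
  apply: (@lipschitz_continuous _ _ _ _ c) => x y.
  by rewrite (_ : F x - F y = F (x - y))// [x - y]addrC -[- y]scaleN1r lF mulN1r addrC.
by exists (Dual Fd).
Qed.

(** * Real integrals and Bochner integrability *)

Section integration.
Context {R : realType}.
Implicit Types (D : set R) (f g : R -> R).
Local Notation mu := (@lebesgue_measure R).

Lemma ae_imp (P Q : R -> Prop) : (forall t, P t -> Q t) ->
  {ae mu, forall t, P t} -> {ae mu, forall t, Q t}.
Proof.
move=> PQ [N [mN N0 PN]]; exists N; split => // t /= nQ; apply: PN => /= Pt.
exact/nQ/PQ.
Qed.

Lemma ae_and (P Q : R -> Prop) : {ae mu, forall t, P t} -> {ae mu, forall t, Q t} ->
  {ae mu, forall t, P t /\ Q t}.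
Proof.
move=> [N [mN N0 PN]] [N' [mN' N'0 QN']]; exists (N `|` N'); split.
- exact: measurableU.
- by rewrite null_set_setU.
- move=> t /= /not_andP[nP|nQ]; [left; exact: PN|right; exact: QN'].
Qed.

Lemma dominated_integrable D f g : measurable D -> measurable_fun setT f ->
  mu.-integrable D (EFin \o g) -> (forall t, D t -> `|f t| <= g t) ->
  mu.-integrable D (EFin \o f).
Proof.
move=> mD mf ig fg; apply: le_integrable ig => // [|t Dt /=].
  by apply/measurable_EFinP; exact: measurable_funTS.
by rewrite lee_fin (le_trans (fg t Dt))// ler_norm.
Qed.

Lemma integrable_indic_bounded D A : measurable D -> measurable A ->
  (mu D < +oo)%E -> mu.-integrable D (fun t => (\1_A t)%:E).
Proof.
move=> mD mA Doo; apply/integrableP; split.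
  by apply/measurable_EFinP; exact: measurable_indic.
rewrite (_ : (fun t => _) = fun t => (\1_A t)%:E).
  rewrite integral_indic//; apply: le_lt_trans Doo.
  by apply: le_measure; rewrite ?inE//; exact: measurableI.
by apply/funext => t /=; rewrite ger0_norm// indicE.
Qed.

Lemma Rintegral_sum D (I : Type) (r : seq I) (f : I -> R -> R) : measurable D ->
  (forall i, mu.-integrable D (EFin \o f i)) ->
  \int[mu]_(t in D) (\sum_(i <- r) f i t) = \sum_(i <- r) \int[mu]_(t in D) f i t.
Proof.
move=> mD If; elim: r => [|i r IH].
  rewrite big_nil (_ : (fun t => _) = cst 0) ?Rintegral_cst ?mul0r//.
  by apply/funext => t; rewrite big_nil.
rewrite big_cons -IH -RintegralD//.
  by apply: eq_Rintegral => t _; rewrite big_cons.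
rewrite (_ : _ \o _ = fun t => (\sum_(j <- r) (EFin \o f j) t)%E).
  exact: integrable_sum.
by apply/funext => t /=; rewrite sumEFin.
Qed.

(** The Borel counterpart of [L1]: by [L1_bochner_integrable] each function in [L1] has such a
    representative, and the estimates are made on representatives. *)
Definition bochner_integrable (B : normedModType R) D (h : R -> B) : Prop :=
  simple_limit h /\ mu.-integrable D (fun t => `|h t|%:E).

Lemma integrable_bound (B : normedModType R) D (h : R -> B) f (c : R) : measurable D ->
  bochner_integrable D h -> measurable_fun setT f ->
  (forall t, D t -> `|f t| <= c * `|h t|) -> mu.-integrable D (EFin \o f).
Proof.
move=> mD [lh ih] mf fh; apply: (dominated_integrable (g := fun t => c * `|h t|)) => //.
by apply: (eq_integrable _ _ _ _ (integrableZl _ c ih)).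
Qed.

Lemma bochner_integrableB (B : normedModType R) D (h h' : R -> B) : measurable D ->
  bochner_integrable D h -> bochner_integrable D h' ->
  bochner_integrable D (fun t => h t - h' t).
Proof.
move=> mD [lh ih] [lh' ih']; split; first exact: simple_limitB.
apply: (@dominated_integrable _ _ (fun t => `|h t| + `|h' t|)) => //.
- by apply: simple_limit_norm; exact: simple_limitB.
- exact: (integrableD _ ih ih').
- by move=> t _; rewrite normr_id ler_normB.
Qed.

(** For a possibly nonmeasurable f, the upper bound is [le_integral_ae_measurable]. For the lower
    one, g is cut off to 0 on the null set N: the result is measurable, has the integral of g and
    lies below f everywhere on D. *)
Lemma integral_ae_measurable D (f g : R -> \bar R) : measurable D ->
  (forall t, D t -> (0 <= f t)%E) -> (forall t, D t -> (0 <= g t)%E) ->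
  measurable_fun D g -> {ae mu, forall t, D t -> f t = g t} ->
  (\int[mu]_(t in D) f t = \int[mu]_(t in D) g t)%E.
Proof.
move=> mD f0 g0 mg fg; apply/eqP; rewrite eq_le; apply/andP; split.
  by apply: le_integral_ae_measurable => //; apply: ae_imp fg => t h Dt; rewrite h.
case: fg => N [mN N0 fN].
apply: (@le_trans _ _ (\int[mu]_(t in D) (g t * (\1_(~` N) t)%:E))%E).
  rewrite (@ae_eq_integral _ _ _ mu D (fun t => g t * (\1_(~` N) t)%:E)%E)//.
    apply: emeasurable_funM => //; apply/measurable_EFinP; apply: measurable_indic.
    exact: measurableC.
  exists N; split => // t /= h; apply: contrapT => Nt; apply: h => Dt.
  by rewrite indicE mem_set// mule1.
apply: le_integral_nonmeasurable => t Dt.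
  by rewrite mule_ge0 ?g0// lee_fin indicE.
rewrite indicE; case: (boolP (t \in ~` N)) => [|_]; last by rewrite mule0 f0.
rewrite inE /= => Nt; rewrite mule1 le_eqVlt; apply/orP; left; apply/eqP.
by apply: contrapT => h; apply: Nt; apply: fN => /= h'; apply: h; rewrite h'.
Qed.

Lemma L1norm_ae_eq (B : normedModType R) D (h h' : R -> B) : measurable D ->
  simple_limit h' -> {ae mu, forall t, D t -> h' t = h t} ->
  L1norm D h = L1norm D h'.
Proof.
move=> mD lh' hh'; apply: integral_ae_measurable => //.
  apply/measurable_EFinP; apply: measurable_funTS; exact: simple_limit_norm.
by apply: ae_imp hh' => t e /e ->.
Qed.

Lemma bochner_integrable_L1norm (B : normedModType R) D (h : R -> B) : measurable D ->
  simple_limit h -> (L1norm D h < +oo)%E -> bochner_integrable D h.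
Proof.
move=> mD lh hoo; split => //; apply/integrableP; split.
  apply/measurable_EFinP; apply: measurable_funTS; exact: simple_limit_norm.
by apply: le_lt_trans hoo; rewrite /L1norm; under eq_integral do rewrite /= normr_id.
Qed.

Lemma L1_bochner_integrable (B : normedModType R) D (h : R -> B) : measurable D ->
  L1 D h -> exists h' : R -> B, [/\ bochner_integrable D h',
    forall t, ~ D t -> h' t = 0 & {ae mu, forall t, D t -> h' t = h t}].
Proof.
move=> mD [/(strongly_measurable_simple_limit mD)[h' [lh' h'0 h'h]] hoo].
exists h'; split => //; apply: bochner_integrable_L1norm => //.
by rewrite -(L1norm_ae_eq mD lh' h'h).
Qed.

Lemma bochner_integrable_L1 (B : normedModType R) D (h : R -> B) : measurable D ->
  (mu D < +oo)%E -> bochner_integrable D h -> L1 D h.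
Proof.
move=> mD Doo [lh ih]; split; first exact: simple_limit_strongly_measurable.
move/integrableP : ih => [_]; rewrite /L1norm.
by under eq_integral do rewrite /= normr_id.
Qed.

End integration.

(** * Bochner integrals with values in the dual *)

Section bochner_in_dual.
Context {R : realType} {V : normedModType R}.
Local Notation mu := (@lebesgue_measure R).
Variable D : set R.
Hypothesis mD : measurable D.
Hypothesis Doo : (mu D < +oo)%E.
Implicit Types (h : R -> dual V) (v : V).

Lemma dual_eval_continuous v : continuous (fun F : dual V => F v : R^o).
Proof.
apply: (@lipschitz_continuous _ _ _ _ `|v|) => F G.
by rewrite mulrC; exact: (dual_boundedP (F - G) v).
Qed.

Lemma dual_eval_simple_limit h v :
  simple_limit h -> measurable_fun setT (fun t => h t v : R).
Proof.
move=> lh; apply: simple_limit_measurable.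
exact: (simple_limit_comp (@dual_eval_continuous v) lh).
Qed.

Lemma dual_eval_integrable h v :
  bochner_integrable D h -> mu.-integrable D (EFin \o (fun t => h t v)).
Proof.
move=> ih; apply: (integrable_bound (c := `|v|) mD ih).
  by apply: dual_eval_simple_limit; case: ih.
by move=> t _; rewrite mulrC dual_boundedP.
Qed.

Lemma dual_eval_sum (I : Type) (r : seq I) (F : I -> dual V) v :
  (\sum_(i <- r) F i) v = \sum_(i <- r) F i v :> R.
Proof. by elim: r => [|i r IH]; rewrite ?big_nil// !big_cons -IH. Qed.

Lemma simple_integral_dualE h v : finitely_valued h ->
  simple_integral D h v = \int[mu]_(t in D) h t v.
Proof.
move=> [fh mh]; rewrite /simple_integral fsbig_finite// dual_eval_sum.
rewrite -[RHS](_ : \int[mu]_(t in D)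
  (\sum_(y <- finmap.enum_fset (fset_set (range h))) y v * \1_(h @^-1` [set y]) t) = _).
  have ind y := integrable_indic_bounded mD (mh y) Doo.
  rewrite Rintegral_sum//; last first.
    by move=> y; apply: (eq_integrable _ _ _ _ (integrableZl _ (y v) (ind y))).
  apply: eq_bigr => y _; rewrite /Rintegral.
  under eq_integral do rewrite EFinM.
  rewrite integralZl// integral_indic//; last exact: mh.
  rewrite classical_sets.setIC fineM//; first exact: mulrC.
  rewrite ge0_fin_numE// (le_lt_trans _ Doo)// le_measure// inE//; apply: measurableI => //; exact: mh.
apply: eq_Rintegral => t _.
rewrite (bigD1_seq (h t)) ?finmap.fset_uniq//=; last first.
  by rewrite in_fset_set// inE; exists t.
rewrite indicE mem_set//= mulr1 big1 ?addr0// => y yt.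
by rewrite indicE memNset ?mulr0// => /= e; rewrite e eqxx in yt.
Qed.

Lemma norm_Rintegral_dual_eval h v : bochner_integrable D h ->
  `|\int[mu]_(t in D) h t v| <= (\int[mu]_(t in D) `|h t|) * `|v|.
Proof.
move=> ih; apply: le_trans (le_normr_Rintegral _ _) _ => //.
  exact: dual_eval_integrable.
rewrite -RintegralZr//; last by case: ih.
apply: le_Rintegral => //.
- by apply/integrable_norm; exact: dual_eval_integrable.
- by case: ih => _ ih; apply: (eq_integrable _ _ _ _ (integrableZr _ `|v| ih)).
- by move=> t _; exact: dual_boundedP.
Qed.

Lemma simple_bochner_integrable h : finitely_valued h -> bochner_integrable D h.
Proof.
move=> fh; have lh := finitely_valued_simple_limit fh; split => //.
pose M := \sum_(y <- finmap.enum_fset (fset_set (range h))) `|y|.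
apply: (@dominated_integrable _ _ _ (cst M)) => //.
- exact: simple_limit_norm.
- by apply: (eq_integrable _ _ _ _ (integrableZl _ M
    (integrable_indic_bounded mD measurableT Doo))) => // t _ /=; rewrite indicT mule1.
- move=> t _; rewrite normr_id /cst /M (bigD1_seq (h t)) ?finmap.fset_uniq//=.
    by rewrite lerDl sumr_ge0.
  by case: fh => fr _; rewrite in_fset_set// inE; exists t.
Qed.

(** I v is the limit of the integrals of s n t v, which differ from the integral of h' t v by at
    most |v| times the L1 norm of h' - s n. *)
Lemma bochner_integral_unique h h' (I : dual V) : bochner_integrable D h' ->
  {ae mu, forall t, D t -> h' t = h t} -> is_bochner_integral D h I ->
  forall v, I v = \int[mu]_(t in D) h' t v.
Proof.
move=> ih' hh' [_ [s [ss sh sI]]] v; apply/eqP; rewrite -subr_eq0 -normr_le0.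
apply/ler_addgt0Pr => e e0; rewrite add0r.
have fs n : finitely_valued (s n) by case: (ss n).
have e1 : 0 < e / 2 / (`|v| + 1) by rewrite !divr_gt0// ltr_wpDl.
have lnorm n : L1norm D (h \- s n) = (\int[mu]_(t in D) `|h' t - s n t|)%:E.
  rewrite (@L1norm_ae_eq _ _ _ _ (fun t => h' t - s n t))//.
  - rewrite /L1norm /Rintegral fineK//; apply: integrable_fin_num => //.
    by case: (bochner_integrableB mD ih' (simple_bochner_integrable (fs n))).
  - by apply: simple_limitB; [case: ih'|exact: finitely_valued_simple_limit].
  - by apply: ae_imp hh' => t /[apply] ->.
have {}sh : \int[mu]_(t in D) `|h' t - s n t| @[n --> \oo] --> (0 : R).
  have /fine_cvgP[_] := sh; apply: cvg_trans; apply: near_eq_cvg.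
  by apply: nearW => n /=; rewrite lnorm.
near \oo => n.
have h1 : `|I - simple_integral D (s n)| <= e / 2 / (`|v| + 1).
  by near: n; exact: cvgr_dist_le sI _ e1.
have h2 : `|\int[mu]_(t in D) `|h' t - s n t| | <= e / 2 / (`|v| + 1).
  by near: n; apply: cvgr0_norm_le sh _ e1.
rewrite (_ : _ - _ = (I - simple_integral D (s n)) v -
  \int[mu]_(t in D) (h' t - s n t) v); last first.
  rewrite -[(I - _) v]/(I v - simple_integral D (s n) v) simple_integral_dualE//.
  rewrite RintegralB//; [ring|exact: dual_eval_integrable|].
  exact/dual_eval_integrable/simple_bochner_integrable.
have v1 (x : R) : `|x| <= e / 2 / (`|v| + 1) -> `|x| * `|v| <= e / 2.
  rewrite ler_pdivlMr ?ltr_wpDl// => h3; apply: le_trans h3.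
  by rewrite ler_wpM2l// lerDl.
rewrite (le_trans (ler_normB _ _))// [leRHS]splitr lerD//.
  apply: le_trans (dual_boundedP _ _) _.
  by rewrite -[`|I - _|]normr_id; apply: v1; rewrite normr_id.
have ib := bochner_integrableB mD ih' (simple_bochner_integrable (fs n)).
apply: le_trans (norm_Rintegral_dual_eval v ib) _.
apply: le_trans (v1 _ h2); rewrite ler_wpM2r// ler_norm//.
Unshelve. all: by end_near.
Qed.

(** The candidate is the weak integral, the bounded functional sending v to the integral of h' t v.
    Simple integrals converge to it in the dual norm because the error at v is at most |v| times the
    L1 distance. *)
Lemma bochner_integral_exists h h' : bochner_integrable D h' ->
  {ae mu, forall t, D t -> h' t = h t} -> strongly_measurable D h ->
  exists I : dual V, is_bochner_integral D h I.
Proof.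
move=> ih' hh' mh; have [lh' nh'] := ih'.
have [s [fs sdom sh]] := dominated_approximation lh'.
have is_ n := simple_bochner_integrable (fs n).
have ib n := bochner_integrableB mD ih' (is_ n).
have lnorm n : L1norm D (h \- s n) = L1norm D (fun t => h' t - s n t).
  rewrite (@L1norm_ae_eq _ _ _ _ (fun t => h' t - s n t))//; first by case: (ib n).
  by apply: ae_imp hh' => t /[apply] ->.
have lim0 : L1norm D (fun t => h' t - s n t) @[n --> \oo] --> (0 : \bar R).
  (* The dominating function 3 |h'| is |h'| plus the bound 2 |h'| on the truncated
     approximations. *)
  have := @dominated_convergence _ _ _ mu D mD (fun n t => `|h' t - s n t|%:E)
    (cst 0%E) (fun t => (3 * `|h' t|)%:E).
  case.
  - move=> n; apply/measurable_EFinP; apply: measurable_funTS.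
    by apply: simple_limit_norm; case: (ib n).
  - exact: measurable_cst.
  - apply: aeW => t _; apply/fine_cvgP; split; first exact: nearW.
    rewrite /comp /=; apply/norm_cvg0P; rewrite -[X in _ --> X](subrr (h' t)).
    by apply: cvgB; [exact: cvg_cst|exact: sh].
  - exact: (integrableZl _ 3 nh').
  - apply: aeW => t n _; rewrite abse_EFin lee_fin normr_id.
    by apply: le_trans (ler_normB _ _) _; have := sdom n t; lra.
  - by move=> _ _; rewrite integral0.
have [I hI] : exists I : dual V, forall v, I v = \int[mu]_(t in D) h' t v.
  apply: (@dual_of_bounded _ _ _ (\int[mu]_(t in D) `|h' t|)) => [k x y|x].
    rewrite -RintegralZl//; last exact: dual_eval_integrable.
    rewrite -RintegralD//; last exact: dual_eval_integrable.
      by apply: eq_Rintegral => t _; rewrite dualD dualZ.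
    by apply: (eq_integrable _ _ _ _ (integrableZl _ k (dual_eval_integrable x ih'))).
  exact: norm_Rintegral_dual_eval.
exists I; split => //; exists s; split=> [n||].
- case: (fs n) => f1 f2; split => // y _.
  apply: le_lt_trans Doo; apply: le_measure; rewrite ?inE//.
  by apply: measurableI => //; exact: f2.
- by under eq_cvg do rewrite lnorm.
- apply/cvgrPdist_le => e e0.
  have /fine_cvgP[_ lim0'] := lim0.
  near=> n; apply: dual_norm_lub => [|v]; first exact: ltW.
  have h1 : `|fine (L1norm D (fun t => h' t - s n t))| <= e.
    by near: n; exact: cvgr0_norm_le lim0' _ e0.
  rewrite -[(I - _) v]/(I v - simple_integral D (s n) v) simple_integral_dualE// hI.
  rewrite -RintegralB//; [|exact: dual_eval_integrable|exact: dual_eval_integrable].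
  apply: le_trans (norm_Rintegral_dual_eval v (ib n)) _.
  by rewrite ler_wpM2r//; apply: le_trans h1; exact: ler_norm.
Unshelve. all: by end_near.
Qed.

(** Existence excludes the default value of [bochner_integral], so the chosen vector is an
    integral. *)
Lemma bochner_integral_dualE h h' : bochner_integrable D h' ->
  {ae mu, forall t, D t -> h' t = h t} -> strongly_measurable D h ->
  forall v, bochner_integral D h v = \int[mu]_(t in D) h' t v.
Proof.
move=> ih' hh' mh; apply: (bochner_integral_unique ih' hh').
by have [I hI] := bochner_integral_exists ih' hh' mh; exact: (xgetPex _ (ex_intro _ I hI)).
Qed.

End bochner_in_dual.

(** * An integral form of Gronwall's lemma *)

Section gronwall.
Context {R : realType}.
Implicit Types (D A : set R) (f g h m : R -> R) (T C : R).
Local Notation mu := (@lebesgue_measure R).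

Lemma lebesgue_measure_cc_fin (x y : R) : (mu `[x, y]%classic < +oo)%E.
Proof. by rewrite lebesgue_measure_itv/=; case: ifP => _; rewrite ?ltry// -EFinB ltry. Qed.

Lemma Rintegral_subset D A m : measurable D -> measurable A -> A `<=` D ->
  mu.-integrable D (EFin \o m) -> (forall t, 0 <= m t) ->
  \int[mu]_(t in A) m t <= \int[mu]_(t in D) m t.
Proof.
move=> mD mA AD im m0; apply: fine_le.
- by apply: integrable_fin_num => //; apply: integrableS im => //.
- exact: integrable_fin_num.
- apply: ge0_subset_integral => //; first by case/integrableP : im.
  by move=> t _; rewrite lee_fin.
Qed.

Lemma ae_le_Rintegral D f g : measurable D ->
  mu.-integrable D (EFin \o f) -> mu.-integrable D (EFin \o g) ->
  (forall t, D t -> 0 <= f t) -> (forall t, D t -> 0 <= g t) ->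
  {ae mu, forall t, D t -> f t <= g t} ->
  \int[mu]_(t in D) f t <= \int[mu]_(t in D) g t.
Proof.
move=> mD fi gi f0 g0 fg; apply: fine_le; [exact: integrable_fin_num..|].
apply: ae_ge0_le_integral => //.
- by case/integrableP : fi.
- by case/integrableP : gi.
Qed.

(* Cut [0, T] into N steps of length at most 1 / (2 C); on each of them the
   memory term is absorbed by the left-hand side. *)
Lemma gronwall_L1 T C : 0 <= T -> 0 <= C -> exists2 E, 0 < E & forall m h,
  mu.-integrable `[0, T] (EFin \o m) -> mu.-integrable `[0, T] (EFin \o h) ->
  (forall t, 0 <= m t) -> (forall t, 0 <= h t) ->
  {ae mu, forall t, `[0, T]%classic t ->
     m t <= h t + C * \int[mu]_(s in `[0, t]) m s} ->
  \int[mu]_(t in `[0, T]) m t <= E * \int[mu]_(t in `[0, T]) h t.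
Proof.
(* The successor keeps N positive when C T = 0. *)
move=> T0 C0; pose N := (Num.truncn (2 * (C * T))).+1.
have CTN : 2 * (C * T) < N%:R by exact: truncnS_gt.
have N0 : 0 < N%:R :> R by rewrite ltr0n.
exists (2 ^+ N.+1) => [|m h im ih m0 h0 mh]; first exact: exprn_gt0.
pose t_ j := j%:R * (T / N%:R).
have t0 j : 0 <= t_ j by rewrite mulr_ge0// divr_ge0// ltW.
have tS j : t_ j <= t_ j.+1 by rewrite ler_wpM2r ?ler_nat// divr_ge0// ltW.
have tT j : (j <= N)%N -> t_ j <= T.
  by move=> jN; rewrite /t_ mulrCA ler_piMr// ler_pdivrMr// mul1r ler_nat.
have sub t : t <= T -> `[0, t]%classic `<=` `[0, T]%classic.
  by move=> tT' s /=; rewrite !in_itv/= => /andP[-> st]; exact: le_trans tT'.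
pose H := \int[mu]_(t in `[0, T]) h t.
have H0 : 0 <= H by apply: Rintegral_ge0 => t _.
pose M j := \int[mu]_(t in `[0, t_ j]) m t.
have M0 j : 0 <= M j by apply: Rintegral_ge0 => t _.
(* With M 0 = 0, the recursion M j.+1 <= 2 M j + 2 H has the solution (2^(j+1) - 2) H, whence the
   constant 2^(N+1). *)
suff key j : (j <= N)%N -> M j <= (2 ^+ j.+1 - 2) * H.
  have := key N (leqnn _); rewrite {1}/M /t_ mulrC divfK ?gt_eqF// => hN.
  by apply: le_trans hN _; rewrite ler_wpM2r// lerBlDr lerDl.
elim: j => [_|j IH jN].
  by rewrite expr1 subrr mul0r /M /t_ mul0r set_itv1 Rintegral_set1.
have {}IH := IH (ltnW jN).
suff step : M j.+1 <= 2 * M j + 2 * H.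
  apply: le_trans step _; rewrite exprS.
  move: IH; move: (2 ^+ j.+1) => P; lra.
pose J := `]t_ j, t_ j.+1]%classic.
have mJ : measurable J by exact: measurable_itv.
have JT : J `<=` `[0, T]%classic.
  move=> s; rewrite /J /= !in_itv/= => /andP[/ltW s1 s2].
  by rewrite (le_trans (t0 j) s1) (le_trans s2)// tT.
have split_J : M j.+1 = M j + \int[mu]_(t in J) m t.
  rewrite /M -Rintegral_setU//.
  - congr (Rintegral _ _ _); apply/seteqP; split=> s; rewrite /J /= !in_itv/=.
      by case: (leP s (t_ j)) => sj /andP[s0 sj1]; [left|right]; rewrite ?s0 ?sj1.
    case=> /andP[s1 s2]; first by rewrite s1 (le_trans s2).
    by rewrite s2 andbT ltW// (le_lt_trans _ s1).
  - apply: integrableS im => //; first exact: measurableU.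
    by move=> s [|/JT//]; apply: sub; exact/tT/ltnW.
  - apply/disj_setPS => s [] /=; rewrite /J /= !in_itv/= => /andP[_ s1] /andP[s2 _].
    by move: (le_lt_trans s1 s2); rewrite ltxx.
have Joo : (mu J < +oo)%E.
  apply: le_lt_trans (lebesgue_measure_cc_fin 0 T).
  by apply: le_measure; rewrite ?inE//.
have iJ : mu.-integrable J (EFin \o m) by apply: integrableS im => //.
have iJh : mu.-integrable J (EFin \o h) by apply: integrableS ih => //.
have iJc : mu.-integrable J (EFin \o cst (C * M j.+1)).
  apply: (eq_integrable _ _ _ _ (integrableZl _ (C * M j.+1)
    (integrable_indic_bounded _ measurableT Joo))) => // t _ /=.
  by rewrite indicT mule1.
(* On J the integral over [0, t] is replaced by the constant M j.+1, which contains the integral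
   over J to be absorbed. *)
have bJ : \int[mu]_(t in J) m t <= \int[mu]_(t in J) (h t + C * M j.+1).
  apply: ae_le_Rintegral => //.
  - exact: (integrableD _ iJh iJc).
  - by move=> t _; rewrite addr_ge0// mulr_ge0.
  - apply: ae_imp mh => t hmt Jt; apply: le_trans (hmt (JT _ Jt)) _.
    rewrite lerD2l ler_wpM2l//; apply: Rintegral_subset => //.
      by move: Jt; rewrite /J /= in_itv/= => /andP[_ tj] s /=;
        rewrite !in_itv/= => /andP[-> st]; exact: le_trans tj.
    by apply: integrableS im => //; exact/sub/tT.
have muJ : fine (mu J) = T / N%:R.
  rewrite /J lebesgue_measure_itv/= lte_fin; case: ltP => [_|].
    by rewrite -EFinB/= /t_ -mulrBl -natrB// subSnn mul1r.
  rewrite /t_ -subr_ge0 -mulrBl -opprB -natrB// subSnn mulN1r oppr_ge0 => h1.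
  by apply/eqP; rewrite eq_le h1 divr_ge0// ltW.
have {}bJ : \int[mu]_(t in J) m t <= H + 2^-1 * M j.+1.
  apply: le_trans bJ _; rewrite RintegralD// Rintegral_cst// muJ; apply: lerD.
    exact: Rintegral_subset.
  rewrite mulrAC ler_wpM2r// mulrA ler_pdivrMr//.
  by rewrite -ler_pdivrMl ?invr_gt0// invrK ltW.
move: bJ; rewrite split_J; lra.
Qed.

End gronwall.

(** * Extension of the kernels beyond the triangle *)

Section memory_kernels.
Context {R : realType}.
Implicit Types (T K : R) (k : R -> R -> R).
Local Notation mu := (@lebesgue_measure R).

(* A kernel on the triangle, extended by zero across the diagonal: the only
   discontinuity of [kap ^~ s] that matters is at [s] itself, a null set. *)
Definition memory_kernel K (kap : R -> R -> R) : Prop :=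
  [/\ forall t, measurable_fun setT (kap t),
      forall t s, `|kap t s| <= K,
      forall t s, ~ (0 <= s <= t) -> kap t s = 0 &
      forall t0 s, 0 <= s -> s != t0 -> kap t s @[t --> t0] --> kap t0 s].

Definition clamp (x y z : R) : R := Num.min (Num.max z x) y.

Lemma clamp_continuous (x : R) (y z : R * R -> R) : continuous y -> continuous z ->
  continuous (fun w => clamp x (y w) (z w)).
Proof.
move=> cy cz w; apply: (@continuous_min _ _ (fun w => Num.max (z w) x) y); last exact: cy.
by apply: (@continuous_max _ _ z (cst x)); [exact: cz|exact: cvg_cst].
Qed.

Lemma clamp_id (x y z : R) : x <= z -> z <= y -> clamp x y z = z.
Proof. by move=> xz zy; rewrite /clamp max_l// min_l. Qed.

Lemma clamp_bounds (x y z : R) : x <= y -> x <= clamp x y z <= y.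
Proof. by move=> xy; rewrite /clamp le_min le_max lexx orbT xy/= ge_min lexx orbT. Qed.

(** [pt] is a continuous retraction of the plane onto the triangle, so [kt] is continuous everywhere
    and keeps the bound of k; the cut-off to [0, t] is applied afterwards. The constant is |M| + 1
    because boundedness is given for constants larger than M. *)
Lemma kernel_extension T k : 0 <= T -> kernel_on_triangle T k ->
  exists K kap, [/\ 0 < K, memory_kernel K kap &
    forall t s, 0 <= s -> s <= t -> t <= T -> kap t s = k t s].
Proof.
move=> T0 [ck [M [_ bk]]].
pose pt (z : R * R) := (clamp 0 T z.1, clamp 0 (clamp 0 T z.1) z.2).
have c1 : continuous (fun z : R * R => clamp 0 T z.1).
  by apply: clamp_continuous => w; [exact: cvg_cst|exact: cvg_fst].
have c2 : continuous (fun z : R * R => clamp 0 (clamp 0 T z.1) z.2).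
  by apply: clamp_continuous => // w; exact: cvg_snd.
have cpt : continuous pt by move=> z; exact: (cvg_pair (c1 z) (c2 z)).
have tpt z : triangle T (pt z).
  have /andP[h1 h2] := @clamp_bounds 0 T z.1 T0.
  by have /andP[h3 h4] := @clamp_bounds 0 _ z.2 h1.
pose kt z := k (pt z).1 (pt z).2.
have ckt : continuous kt.
  move=> z.
  have := (subspace_continuousP (triangle T) (fun z : R * R => k z.1 z.2)).1 ck _ (tpt z).
  apply: cvg_trans; rewrite /kt => P /= hP.
  have := cpt z _ hP; rewrite /= !nbhs_simpl/= => h.
  by apply: filterS h => w /= h; exact: h (tpt w).
have cpr (t : R) : continuous (fun s : R => (t, s)).
  by move=> s; apply: (@cvg_pair _ _ _ _ (nbhs t) (nbhs s)); [exact: cvg_cst|exact: cvg_id].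
have cpl (s : R) : continuous (fun t : R => (t, s)).
  by move=> t; apply: (@cvg_pair _ _ _ _ (nbhs t) (nbhs s)); [exact: cvg_id|exact: cvg_cst].
pose kap t s := \1_(`[0, t]%classic) s * kt (t, s).
exists (`|M| + 1), kap; split; first by rewrite ltr_wpDl.
  split=> [t|t s|t s h|t0 s s0 st0].
  - apply: measurable_funM; first by apply: measurable_indic; exact: measurable_itv.
    apply: continuous_measurable_fun => s; apply: (@continuous_comp _ _ _ (fun s => (t, s)) kt).
      exact: cpr.
    exact: ckt.
  - rewrite /kap normrM; apply: (@le_trans _ _ (1 * (`|M| + 1))); last by rewrite mul1r.
    apply: ler_pM => //; first by rewrite indicE; case: (_ \in _); rewrite ?normr1 ?normr0.
    by apply: (bk _ _ _ (tpt (t, s))); rewrite (le_lt_trans (ler_norm M))// ltrDl.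
  - by rewrite /kap indicE memNset ?mul0r//= in_itv/= => /h.
  - have ct : kt (t, s) @[t --> t0] --> kt (t0, s).
      apply: (@continuous_comp _ _ _ (fun t => (t, s)) kt); last exact: ckt.
      exact: cpl.
    apply: cvgM => //; apply: cvg_near_cst.
    (* Off the diagonal the cut-off is locally constant in t: 1 if s < t0 and 0 if s > t0. *)
    have [st|ts|e] := ltgtP s t0; last by rewrite e eqxx in st0.
    + near=> t; rewrite !indicE !mem_set//= in_itv/= s0/=; first exact: ltW.
      by apply/ltW; near: t; exact: lt_nbhsr.
    + near=> t; rewrite !indicE !memNset//= in_itv/= s0/=; apply/negP; rewrite -ltNge//.
      by near: t; exact: lt_nbhsl.
move=> t s s0 st tT; rewrite /kap indicE mem_set/= ?in_itv/= ?s0// mul1r /kt /pt/=.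
by rewrite (@clamp_id 0 T)// ?clamp_id// (le_trans s0).
Unshelve. all: by end_near.
Qed.

End memory_kernels.

(** * Weak Volterra integrals in a Hilbert space *)

Section volterra_integral.
Context {R : realType} {H : hilbertType R}.
Variables (T K : R) (kap : R -> R -> R).
Hypothesis kapK : memory_kernel K kap.
Hypothesis K_gt0 : 0 < K.
Implicit Types (h : R -> H) (v w : H) (f : R -> R) (t s : R).
Local Notation mu := (@lebesgue_measure R).
Local Notation D := (`[0, T]%classic).

Let mD : measurable D. Proof. exact: measurable_itv. Qed.

(** Memory integrals are written over the fixed interval [0, T], with t in the kernel only, so that
    linearity and limits in t concern a single domain; this returns to [0, t]. *)
Lemma Rintegral_memory f t : t <= T -> (forall s, ~ (0 <= s <= t) -> f s = 0) ->
  \int[mu]_(s in `[0, T]) f s = \int[mu]_(s in `[0, t]) f s.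
Proof.
move=> tT f0.
have -> : `[0, t]%classic = `[0, T]%classic `&` `[0, t]%classic.
  apply/seteqP; split=> s /=; rewrite !in_itv/=; last by case.
  by move=> /andP[-> st]; rewrite st (le_trans st).
rewrite Rintegral_mkcondr; apply: eq_Rintegral => s _.
rewrite /patch; case: ifPn => //; rewrite notin_setE /= in_itv/= => /f0 ->.
by [].
Qed.

Lemma kernel_integrable f t : measurable_fun setT f ->
  mu.-integrable D (EFin \o f) -> mu.-integrable D (EFin \o (fun s => kap t s * f s)).
Proof.
case: kapK => mk bk _ _ mf fi.
apply: (@dominated_integrable _ _ _ (fun s => K * `|f s|)) => //.
- by apply: measurable_funM => //; exact: mk.
- by apply: (eq_integrable _ _ _ _ (integrableZl _ K (integrable_norm fi))).
- by move=> s _; rewrite normrM ler_wpM2r.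
Qed.

Lemma inner_integrable h v : bochner_integrable D h ->
  measurable_fun setT (fun s => inner (h s) v : R) /\
  mu.-integrable D (EFin \o (fun s => inner (h s) v)).
Proof.
move=> ih; have mf : measurable_fun setT (fun s => inner (h s) v : R).
  apply: simple_limit_measurable.
  apply: (@simple_limit_comp _ H R^o (fun x => inner x v)); last by case: ih.
  apply: (@lipschitz_continuous _ _ _ _ `|v|) => x y.
  by rewrite -innerBl mulrC inner_Cauchy_Schwarz.
split => //; apply: (integrable_bound (c := `|v|) mD ih mf) => s _.
by rewrite mulrC inner_Cauchy_Schwarz.
Qed.

Lemma bochner_integrable_norm h : bochner_integrable D h ->
  measurable_fun setT (fun s => `|h s|) /\ mu.-integrable D (EFin \o (fun s => `|h s|)).
Proof. by move=> [lh ih]; split => //; exact: simple_limit_norm. Qed.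

Lemma norm_le_inner w (c : R) : 0 <= c -> (forall v, `|inner w v : R| <= c * `|v|) -> `|w| <= c.
Proof.
move=> c0 wc; have [->|w0] := eqVneq w 0; first by rewrite normr0.
rewrite -(@ler_pM2r _ `|w|) ?normr_gt0// -expr2 -inner_norm.
exact: le_trans (ler_norm _) (wc w).
Qed.

Lemma volterra_functional_le (l : R -> R) h v : measurable_fun setT l ->
  (exists M, forall s, `|l s| <= M) -> bochner_integrable D h ->
  `|\int[mu]_(s in D) (l s * inner (h s) v)| <=
    (\int[mu]_(s in D) (`|l s| * `|h s|)) * `|v|.
Proof.
move=> ml [M lM] ih; have [mf fi] := inner_integrable v ih.
have [mn ni] := bochner_integrable_norm ih.
have il : mu.-integrable D (EFin \o (fun s => l s * inner (h s) v)).
  apply: (@dominated_integrable _ _ _ (fun s => M * `|inner (h s) v : R|)) => //.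
  - exact: measurable_funM.
  - by apply: (eq_integrable _ _ _ _ (integrableZl _ M (integrable_norm fi))).
  - by move=> s _; rewrite normrM ler_wpM2r.
have ia : mu.-integrable D (EFin \o (fun s => `|l s| * `|h s|)).
  apply: (@dominated_integrable _ _ _ (fun s => M * `|h s|)) => //.
  - by apply: measurable_funM => //; exact: measurableT_comp.
  - by apply: (eq_integrable _ _ _ _ (integrableZl _ M ni)).
  - by move=> s _; rewrite normrM !normr_id ler_wpM2r.
apply: le_trans (le_normr_Rintegral _ _) _ => //.
rewrite -RintegralZr//; apply: le_Rintegral => //.
- exact: (integrable_norm il).
- by apply: (eq_integrable _ _ _ _ (integrableZr _ `|v| ia)).
- by move=> s _; rewrite normrM -mulrA ler_wpM2l// inner_Cauchy_Schwarz.
Qed.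

(** The Volterra integral of kap t s *: h s, defined by its inner products. For integrable h the
    Riesz representation provides such a vector, which is [voltE]. *)
Definition volt h t : H := xget 0 [set w |
  forall v, inner w v = \int[mu]_(s in `[0, T]) (kap t s * inner (h s) v)].

Lemma voltE h t v : bochner_integrable D h ->
  inner (volt h t) v = \int[mu]_(s in `[0, T]) (kap t s * inner (h s) v).
Proof.
move=> ih; have [mk bk _ _] := kapK.
suff hP : exists w : H, [set w : H | forall v,
    inner w v = \int[mu]_(s in D) (kap t s * inner (h s) v)] w.
  exact: (xgetPex 0 hP).
have [|x|F hF] := @dual_of_bounded R H
    (fun v => \int[mu]_(s in D) (kap t s * inner (h s) v))
    (\int[mu]_(s in D) (`|kap t s| * `|h s|)).
- move=> k x y; have [mx ix] := inner_integrable x ih.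
  have [my iy] := inner_integrable y ih.
  rewrite -RintegralZl//; last exact: kernel_integrable.
  rewrite -RintegralD//; last exact: kernel_integrable.
    by apply: eq_Rintegral => s _; rewrite innerDr innerZr; ring.
  by apply: (eq_integrable _ _ _ _ (integrableZl _ k (kernel_integrable t mx ix))).
- by apply: volterra_functional_le => //; exists K.
- by exists (rep F) => v'; rewrite repE hF.
Qed.

Lemma volt_norm_le h t : bochner_integrable D h -> t <= T ->
  `|volt h t| <= K * \int[mu]_(s in `[0, t]) `|h s|.
Proof.
move=> ih tT; have [mk bk k0 _] := kapK.
have [mn ni] := bochner_integrable_norm ih.
have sub : `[0, t]%classic `<=` D.
  by move=> s /=; rewrite !in_itv/= => /andP[-> st]; exact: le_trans tT.
have ni' : mu.-integrable `[0, t] (EFin \o (fun s => `|h s|)).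
  by apply: integrableS ni => //; exact: measurable_itv.
have I0 : 0 <= \int[mu]_(s in `[0, t]) `|h s| by apply: Rintegral_ge0.
apply: norm_le_inner => [|v]; first by rewrite mulr_ge0// ltW.
rewrite voltE//; apply: le_trans (volterra_functional_le v (mk t) _ ih) _; first by exists K.
rewrite ler_wpM2r// (Rintegral_memory tT); last by move=> s /k0 ->; rewrite normr0 mul0r.
rewrite -RintegralZl//; apply: le_Rintegral => //.
- apply: (@dominated_integrable _ _ _ (fun s => K * `|h s|)) => //.
  + by apply: measurable_funM => //; exact: measurableT_comp.
  + by apply: (eq_integrable _ _ _ _ (integrableZl _ K ni')).
  + by move=> s _; rewrite normrM !normr_id ler_wpM2r.
- by apply: (eq_integrable _ _ _ _ (integrableZl _ K ni')).
- by move=> s _; rewrite ler_wpM2r.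
Qed.

Lemma voltB h h' t : bochner_integrable D h -> bochner_integrable D h' ->
  volt h t - volt h' t = volt (fun s => h s - h' s) t.
Proof.
move=> ih ih'; have ib := bochner_integrableB mD ih ih'.
apply: inner_nondegenerate => v; rewrite innerBl !voltE//.
have [mf fi] := inner_integrable v ih; have [mf' fi'] := inner_integrable v ih'.
rewrite -RintegralB//; [|exact: kernel_integrable|exact: kernel_integrable].
by apply: eq_Rintegral => s _; rewrite innerBl; ring.
Qed.

(** The left-hand side is the inner product of [volt h t] with B^* q, so the form passes under the
    integral. *)
Lemma volt_cbilinear (W : hilbertType R) (b : cbilinear H W) h t (q : W) :
  bochner_integrable D h ->
  b (volt h t) q = \int[mu]_(s in `[0, T]) (kap t s * b (h s) q).
Proof.
move=> ih; rewrite -(rep_op_flipE b) innerC voltE//.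
by apply: eq_Rintegral => s _; rewrite innerC rep_op_flipE.
Qed.

(** The difference of two values is bounded, uniformly in the test vector, by the scalar integral G
    t. Dominated convergence along sequences sends G to 0, with s = t0 as exceptional point and 2 K
    |h| as bound. *)
Lemma volt_continuous h : bochner_integrable D h -> continuous (volt h).
Proof.
move=> ih t0; have [mk bk k0 ck] := kapK.
have [mn ni] := bochner_integrable_norm ih.
pose G t := \int[mu]_(s in D) (`|kap t s - kap t0 s| * `|h s|).
have bd t s : `|kap t s - kap t0 s| <= 2 * K.
  by apply: le_trans (ler_normB _ _) _; rewrite mulr2n mulrDl mul1r lerD.
have dG t : `|volt h t0 - volt h t| <= G t.
  rewrite -normrN opprB; apply: norm_le_inner => [|v].
    by apply: Rintegral_ge0 => s _; rewrite mulr_ge0.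
  have [mf fi] := inner_integrable v ih.
  rewrite innerBl !voltE// -RintegralB//; [|exact: kernel_integrable|exact: kernel_integrable].
  rewrite [X in `|X| <= _](_ : _ =
    \int[mu]_(s in D) ((kap t s - kap t0 s) * inner (h s) v)).
    apply: volterra_functional_le => //; first by apply: measurable_funB; exact: mk.
    by exists (2 * K).
  by apply: eq_Rintegral => s _; rewrite mulrBl.
suff Gcvg : G t @[t --> t0] --> (0 : R).
  apply/cvgrPdist_le => e e0; near=> t; apply: le_trans (dG t) _.
  apply: le_trans (ler_norm _) _.
  by near: t; exact: cvgr0_norm_le Gcvg _ e0.
apply/(@cvg_nbhsP _ R^o) => u ut0.
have := @dominated_convergence _ _ _ mu D mD
  (fun n s => (`|kap (u n) s - kap t0 s| * `|h s|)%:E)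
  (cst 0%E) (fun s => (2 * K * `|h s|)%:E).
case.
- move=> n; apply/measurable_EFinP; apply: measurable_funTS; apply: measurable_funM => //.
  by apply: measurableT_comp => //; apply: measurable_funB; exact: mk.
- exact: measurable_cst.
- exists [set t0]; split => //; first exact: lebesgue_measure_set1.
  move=> s /= hs; apply: contrapT => /eqP st0; apply: hs; rewrite in_itv/= => /andP[s0 _].
  apply/fine_cvgP; split; first exact: nearW.
  rewrite /comp /= -[X in _ --> X](mul0r `|h s|); apply: cvgM; last exact: cvg_cst.
  apply/norm_cvg0P; rewrite -[X in _ --> X](subrr (kap t0 s)).
  apply: cvgB; last exact: cvg_cst.
  exact: (cvg_comp _ _ ut0 (ck _ _ s0 st0)).
- by apply: (eq_integrable _ _ _ _ (integrableZl _ (2 * K) ni)).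
- apply: aeW => s n _; rewrite abse_EFin lee_fin normrM !normr_id.
  exact: ler_wpM2r.
- move=> _ _; rewrite integral0 => /fine_cvgP[_].
  exact.
Unshelve. all: by end_near.
Qed.

End volterra_integral.

(** * Fixed points in an exponentially weighted norm *)

Section picard.
Context {R : realType}.
Local Notation mu := (@lebesgue_measure R).

(** Integrating the weight gains a factor 1 / c; a large c thus makes the memory operator a
    contraction. *)
Lemma integral_exp_weight (c t : R) : 0 < c -> 0 <= t ->
  mu.-integrable `[0, t] (EFin \o (fun s => expR (c * s))) /\
  c * \int[mu]_(s in `[0, t]) expR (c * s) <= expR (c * t).
Proof.
move=> c0 t0; have cexp : continuous (fun s : R => expR (c * s)).
  move=> s; apply: (@continuous_comp _ _ _ (fun s => c * s) expR); last exact: continuous_expR.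
  exact: mulrl_continuous.
have iexp : mu.-integrable `[0, t] (EFin \o (fun s => expR (c * s))).
  apply: continuous_compact_integrable; first exact: segment_compact.
  exact: continuous_subspaceT.
split => //; move: t0; rewrite le_eqVlt => /orP[/eqP <-|t0].
  by rewrite set_itv1 Rintegral_set1 mulr0 expR_ge0.
have dF (s : R) : is_derive s 1 (fun s : R => expR (c * s)) (c * expR (c * s)).
  by apply: is_derive_eq; rewrite /GRing.scale/=; ring.
have := @continuous_FTC2 R (fun s => c * expR (c * s)) (fun s => expR (c * s)) 0 t t0.
rewrite -RintegralZl// => FTC; rewrite /Rintegral FTC.
- by rewrite mulr0 expR0 -EFinB/= lerBlDr lerDl.
- apply: continuous_subspaceT => s; apply: cvgM; [exact: cvg_cst|exact: cexp].
- split; first by move=> s _; have [] := dF s.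
    by apply: cvg_at_right_filter; exact: cexp.
  by apply: cvg_at_left_filter; exact: cexp.
- by move=> s _; rewrite derive1E derive_val.
Qed.

(* Contraction for the sup norm with weight [om]; [clamp 0 T] makes the iterates
   depend on the values in [0, T] only. *)
Lemma weighted_fixpoint (V : completeNormedModType R) (T Om A : R) (om : R -> R)
    (N : (R -> V) -> R -> V) : 0 <= T ->
  (forall s, 0 <= s <= T -> 1 <= om s <= Om) ->
  (forall z, continuous z -> continuous (N z)) ->
  (forall z z' c, continuous z -> continuous z' -> 0 <= c ->
    (forall s, 0 <= s <= T -> `|z s - z' s| <= c * om s) ->
    forall t, 0 <= t <= T -> `|N z t - N z' t| <= c / 2 * om t) ->
  (forall t, 0 <= t <= T -> `|N (cst 0) t| <= A) ->
  exists2 z : R -> V, continuous z & forall t, 0 <= t <= T -> N z t = z t.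
Proof.
move=> T0 om1 cN contr NA.
pose cl t : R := clamp 0 T t.
have clT t : 0 <= cl t <= T by exact: clamp_bounds.
have clK t : 0 <= t <= T -> cl t = t by move=> /andP[t0 tT]; exact: clamp_id.
have ccl : continuous cl.
  move=> t; apply: (@continuous_min _ _ (fun z : R => Num.max z 0) (cst T)); last exact: cvg_cst.
  by apply: (@continuous_max _ _ id (cst 0)); [exact: cvg_id|exact: cvg_cst].
have A0 : 0 <= A by apply: le_trans (NA 0 _); rewrite // lexx.
have Om1 : 1 <= Om by have /andP[h1 h2] := om1 0 (introT andP (conj (lexx _) T0)); exact: le_trans h2.
pose zs := fix zs n : R -> V := if n is n'.+1 then N (zs n') \o cl else cst 0.
have zsS n t : zs n.+1 t = N (zs n) (cl t) by [].
have czs n : continuous (zs n).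
  elim: n => [|n IH] /=; first exact: cst_continuous.
  by move=> t; apply: (@continuous_comp _ _ _ cl (N (zs n))); [exact: ccl|exact: cN].
have step n t : `|zs n.+1 (cl t) - zs n (cl t)| <= A / 2 ^+ n * om (cl t).
  elim: n t => [|n IH] t.
    rewrite /= subr0 expr0 divr1 (clK _ (clT t)).
    apply: le_trans (NA _ (clT t)) _.
    by rewrite ler_peMr//; have /andP[] := om1 _ (clT t).
  rewrite (zsS n.+1) (zsS n) (clK _ (clT t)) exprSr invfM mulrA.
  apply: contr => //; first by rewrite divr_ge0// exprn_ge0.
  by move=> s sT; have := IH s; rewrite clK.
(* From index 1 on the iterates factor through the clamp by definition, so a bound on [0, T] holds
   on the whole line; the weight is replaced by its upper bound Om. *)
have unif_step n t : `|zs n.+2 t - zs n.+1 t| <= A * Om / 2 ^+ n.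
  have -> : zs n.+2 t = zs n.+2 (cl t) by rewrite /= (clK _ (clT t)).
  have -> : zs n.+1 t = zs n.+1 (cl t) by rewrite /= (clK _ (clT t)).
  apply: le_trans (step _ _) _; have /andP[h1 h2] := om1 _ (clT t).
  rewrite [leRHS]mulrAC; apply: ler_pM => //.
  - by rewrite divr_ge0// exprn_ge0.
  - exact: le_trans h1.
  - by rewrite ler_wpM2l// lef_pV2 ?posrE ?exprn_gt0// exprS ler_peMl ?exprn_ge0// ler1n.
pose B := 2 * (A * Om); have B0 : 0 <= B by rewrite !mulr_ge0// (le_trans ler01).
(* B = 2 A Om makes the right-hand side the exact geometric sum of the step bounds with indices n to
   n + k - 1. *)
have tail n k t : `|zs (n + k).+1 t - zs n.+1 t| <= B / 2 ^+ n - B / 2 ^+ (n + k).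
  elim: k => [|k IH]; first by rewrite addn0 !subrr normr0.
  rewrite addnS (le_trans (ler_distD (zs (n + k).+1 t) _ _))//.
  apply: le_trans (lerD (unif_step _ t) IH) _.
  rewrite /B exprSr invfM; move: (2 ^+ n)^-1 (2 ^+ (n + k))^-1 => x y; lra.
have unif n m t : (n <= m)%N -> `|zs m.+1 t - zs n.+1 t| <= B / 2 ^+ n.
  move=> nm; rewrite -(subnKC nm); apply: le_trans (tail _ _ _) _.
  by rewrite lerBlDr lerDl divr_ge0// exprn_ge0.
have small e : 0 < e -> exists n : nat, B / 2 ^+ n < e.
  move=> e0; have [|n hn] := @invn_lt R (e / (B + 1)); first by rewrite divr_gt0// ltr_wpDl.
  exists n.+1; have n0 : 0 < n.+1%:R :> R by rewrite ltr0n.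
  have := hn n (leqnn n); rewrite ltr_pdivlMr ?ltr_wpDl// => h.
  apply: le_lt_trans h; apply: (@le_trans _ _ (B / n.+1%:R)).
    rewrite ler_wpM2l// lef_pV2 ?posrE ?exprn_gt0// -natrX ler_nat.
    exact/ltnW/ltn_expl.
  by rewrite mulrC ler_wpM2l ?invr_ge0 ?(ltW n0)// lerDl.
have /choice[z hz] t : exists l : V, zs n.+1 t @[n --> \oo] --> l.
  apply: cauchy_seq_cvg => e e0; have [|n hn] := small (e / 2); first exact: divr_gt0.
  exists n => p q np nq; rewrite (le_lt_trans (ler_distD (zs n.+1 t) _ _))//.
  rewrite [ltRHS]splitr ltrD ?(le_lt_trans _ hn)// ?unif// distrC unif//.
have zlim n t : `|z t - zs n.+1 t| <= B / 2 ^+ n.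
  apply/ler_addgt0Pr => e e0.
  near \oo => m.
  have h1 : `|z t - zs m.+1 t| <= e by near: m; exact: cvgr_dist_le (hz t) _ e0.
  rewrite (le_trans (ler_distD (zs m.+1 t) _ _))// addrC lerD// unif//.
  by near: m; exists n.
have cz : continuous z.
  move=> t; apply/cvgrPdist_le => e e0.
  have [|n hn] := small (e / 3); first exact: divr_gt0.
  near=> s.
  have h1 : `|zs n.+1 t - zs n.+1 s| <= e / 3.
    by near: s; apply: cvgr_dist_le (czs n.+1 t) _ _; exact: divr_gt0.
  rewrite (le_trans (ler_distD (zs n.+1 t) _ _))// (_ : e = e / 3 + (e / 3 + e / 3)); last by field.
  rewrite lerD ?(le_trans (zlim _ _) (ltW hn))//.
  rewrite (le_trans (ler_distD (zs n.+1 s) _ _))// lerD// distrC.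
  exact: le_trans (zlim _ _) (ltW hn).
exists z => // t tT; apply/eqP; rewrite -subr_eq0 -normr_le0.
apply/ler_addgt0Pr => e e0; rewrite add0r.
have [|n hn] := small (e / (2 * Om)); first by rewrite divr_gt0// mulr_gt0// (lt_le_trans ltr01).
have OmE : e / (2 * Om) * Om = e / 2 by field; rewrite gt_eqF// (lt_le_trans ltr01).
have Om0 : 0 <= Om by exact: le_trans Om1.
have hnO : B / 2 ^+ n * Om <= e / 2 by rewrite -OmE ler_wpM2r// ltW.
have Bn0 : 0 <= B / 2 ^+ n by rewrite divr_ge0// exprn_ge0.
(* The intermediate point is N applied to iterate n + 1: its distance to N z is bounded by the
   contraction property, its distance to z by uniform convergence. *)
rewrite (le_trans (ler_distD (zs n.+2 t) _ _))// [leRHS]splitr lerD//.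
  rewrite zsS (clK _ tT).
  apply: (@le_trans _ _ (B / 2 ^+ n / 2 * om t)).
    apply: contr => // s sT; apply: le_trans (zlim n s) _.
    by rewrite ler_peMr//; have /andP[] := om1 _ sT.
  have /andP[h1 h2] := om1 _ tT.
  apply: le_trans hnO; apply: ler_pM => //; [by rewrite divr_ge0|exact: le_trans h1|].
  lra.
rewrite distrC; apply: le_trans (zlim n.+1 t) _; apply: le_trans hnO.
apply: (@le_trans _ _ (B / 2 ^+ n)); last by rewrite ler_peMr.
by rewrite ler_wpM2l// lef_pV2 ?posrE ?exprn_gt0// exprS ler_peMl// ?exprn_ge0// ler1n.
Unshelve. all: by end_near.
Qed.

End picard.

(** * Stability of Bochner integrability *)

Section bochner_integrable_theory.
Context {R : realType}.
Implicit Types (B C : normedModType R) (D : set R).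
Local Notation mu := (@lebesgue_measure R).

Lemma bochner_integrable_bound B C D (h : R -> B) (h' : R -> C) (c : R) :
  measurable D -> bochner_integrable D h -> simple_limit h' ->
  (forall t, D t -> `|h' t| <= c * `|h t|) -> bochner_integrable D h'.
Proof.
move=> mD ih lh' hh'; split => //.
apply: (integrable_bound (c := c) mD ih); first exact: simple_limit_norm.
by move=> t Dt; rewrite normr_id hh'.
Qed.

Lemma bochner_integrable_comp B C D (phi : B -> C) (h : R -> B) (c : R) : measurable D ->
  continuous phi -> (forall x, `|phi x| <= c * `|x|) -> bochner_integrable D h ->
  bochner_integrable D (fun t => phi (h t)).
Proof.
move=> mD cphi bphi ih; apply: (bochner_integrable_bound (c := c) mD ih) => //.
by apply: (simple_limit_comp cphi); case: ih.
Qed.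

Lemma bochner_integrableD B D (h h' : R -> B) : measurable D ->
  bochner_integrable D h -> bochner_integrable D h' ->
  bochner_integrable D (fun t => h t + h' t).
Proof.
move=> mD [lh ih] [lh' ih']; split; first exact: simple_limitD.
apply: (@dominated_integrable _ _ _ (fun t => `|h t| + `|h' t|)) => //.
- by apply: simple_limit_norm; exact: simple_limitD.
- exact: (integrableD _ ih ih').
- by move=> t _; rewrite normr_id ler_normD.
Qed.

Lemma bochner_integrableS B D D' (h : R -> B) : measurable D -> measurable D' ->
  D' `<=` D -> bochner_integrable D h -> bochner_integrable D' h.
Proof. by move=> mD mD' sub [lh ih]; split => //; apply: integrableS ih. Qed.

Lemma Rintegral_norm_ge0 B D (h : R -> B) : 0 <= \int[mu]_(t in D) `|h t|.
Proof. exact: Rintegral_ge0. Qed.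

Lemma Rintegral_norm_le B C D (h : R -> B) (h' : R -> C) (c : R) : measurable D ->
  bochner_integrable D h -> bochner_integrable D h' -> 0 <= c ->
  {ae mu, forall t, D t -> `|h t| <= c * `|h' t|} ->
  \int[mu]_(t in D) `|h t| <= c * \int[mu]_(t in D) `|h' t|.
Proof.
move=> mD [lh ih] [lh' ih'] c0 hh'; rewrite -RintegralZl//.
apply: ae_le_Rintegral => //.
- by apply: (eq_integrable _ _ _ _ (integrableZl _ c ih')).
- by move=> t _; rewrite mulr_ge0.
Qed.

End bochner_integrable_theory.

Section rep_op_lipschitz.
Context {R : realType} {V : normedModType R} {W : hilbertType R}.
Variable b : cbilinear V W.

Lemma rep_op_bound : exists2 M, 0 < M & forall v, `|rep_op b v| <= M * `|v|.
Proof.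
have [M M0 hM] := cbilinear_bounded b; exists M => // v.
by apply: rep_op_bounded => //; exact: ltW.
Qed.

Lemma rep_opB v v' : rep_op b (v - v') = rep_op b v - rep_op b v'.
Proof. by rewrite -scaleN1r rep_opD rep_opZ scaleN1r. Qed.

Lemma rep_op_continuous : continuous (rep_op b).
Proof.
have [M M0 hM] := rep_op_bound; apply: (@lipschitz_continuous _ _ _ _ M) => x y.
by rewrite -rep_opB.
Qed.

Lemma bochner_integrable_rep_op D (h : R -> V) : measurable D ->
  bochner_integrable D h -> bochner_integrable D (fun t => rep_op b (h t)).
Proof.
move=> mD ih; have [M M0 hM] := rep_op_bound.
by apply: (bochner_integrable_comp (c := M) mD) => //; exact: rep_op_continuous.
Qed.

End rep_op_lipschitz.

(** * A priori estimates for the Volterra problem *)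

Section estimates.
Context {R : realType} {V Q : hilbertType R}.
Variables (a : cbilinear V V) (b : cbilinear V Q) (alpha beta M : R).
Hypothesis a_sym : forall w v, a w v = a v w.
Hypothesis a_ge0 : forall v, 0 <= a v v.
Hypothesis alpha_gt0 : 0 < alpha.
Hypothesis a_coercive : forall v, (forall q, b v q = 0) -> alpha * `|v| ^+ 2 <= a v v.
Hypothesis beta_gt0 : 0 < beta.
Hypothesis b_inf_sup : inf_sup b beta.
Hypothesis M_gt0 : 0 < M.
Hypothesis a_bounded : forall v w, `|a v w| <= M * `|v| * `|w|.
Variables (T K1 K2 : R) (kap1 kap2 : R -> R -> R).
Hypothesis T_ge0 : 0 <= T.
Hypothesis kap1K : memory_kernel K1 kap1.
Hypothesis K1_gt0 : 0 < K1.
Hypothesis kap2K : memory_kernel K2 kap2.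
Hypothesis K2_gt0 : 0 < K2.
Implicit Types (u f : R -> V) (p g : R -> Q) (t l : R).

Local Notation mu := (@lebesgue_measure R).
Local Notation D := (`[0, T]%classic).
Local Notation A := (rep_op a).
Local Notation B := (rep_op b).
Local Notation Bt := (rep_op (flip b)).

Definition memory u p t : V :=
  volt T kap1 (fun s => A (u s)) t + volt T kap2 (fun s => Bt (p s)) t.

Definition weak_solution l f g u p : Prop :=
  {ae mu, forall t, `[0, T]%classic t ->
    saddle a b l (f t + memory u p t) (g t) (u t) (p t)}.

Let mD : measurable D. Proof. exact: measurable_itv. Qed.

Let sub t : t <= T -> `[0, t]%classic `<=` D.
Proof. by move=> tT s /=; rewrite !in_itv/= => /andP[-> st]; exact: le_trans tT. Qed.

Let bI (W : normedModType R) (h : R -> W) t : t <= T ->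
  bochner_integrable D h -> bochner_integrable `[0, t] h.
Proof. by move=> tT; apply: bochner_integrableS => //; exact: sub. Qed.

Lemma memoryE u p t v : bochner_integrable D u -> bochner_integrable D p ->
  inner (memory u p t) v = \int[mu]_(s in `[0, T]) (kap1 t s * a (u s) v) +
    \int[mu]_(s in `[0, T]) (kap2 t s * b v (p s)).
Proof.
move=> iu ip; rewrite innerDl.
rewrite (voltE kap1K)//; last exact: bochner_integrable_rep_op.
rewrite (voltE kap2K)//; last exact: bochner_integrable_rep_op.
by congr (_ + _); apply: eq_Rintegral => s _; rewrite rep_opE.
Qed.

Lemma p_estimate : exists2 C, 0 < C & forall l f g u p, 0 < l ->
  bochner_integrable D f -> bochner_integrable D g ->
  bochner_integrable D u -> bochner_integrable D p -> weak_solution l f g u p ->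
  \int[mu]_(t in `[0, T]) `|p t| <=
    C * (\int[mu]_(t in `[0, T]) `|f t| + \int[mu]_(t in `[0, T]) `|g t|).
Proof.
have [C0 C00 hC0] := saddle_dual_bound a_sym a_ge0 alpha_gt0 a_coercive beta_gt0
  b_inf_sup M_gt0 a_bounded.
have [N N0 hN] := rep_op_bound (flip b).
(* From |A u| <= |F| + N |p| and |p| <= C0 (|F| + |g|), the m defined below is at most |F| + 2 N C0
   (|F| + |g|). *)
pose C1 := 1 + 2 * N * C0.
have C10 : 0 < C1 by rewrite addr_gt0// !mulr_gt0.
have K0 : 0 <= C1 * (K1 + K2) by apply: mulr_ge0; [exact: ltW|apply: addr_ge0; exact: ltW].
have [E E0 hE] := gronwall_L1 T_ge0 K0.
exists (E * C1 / N) => [|l f g u p l0 i_f ig iu ip sol]; first by rewrite divr_gt0// mulr_gt0.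
have iA : bochner_integrable D (fun t => A (u t)) by exact: bochner_integrable_rep_op.
have iB : bochner_integrable D (fun t => Bt (p t)) by exact: bochner_integrable_rep_op.
pose m t := `|A (u t)| + N * `|p t|.
have m0 t : 0 <= m t by rewrite addr_ge0// mulr_ge0// ltW.
have iNp : mu.-integrable D (EFin \o (fun t => N * `|p t|)).
  by case: ip => _ ip; apply: (eq_integrable _ _ _ _ (integrableZl _ N ip)).
have im : mu.-integrable D (EFin \o m) by case: iA => _ iA; exact: (integrableD _ iA iNp).
have [_ i1] := i_f; have [_ i2] := ig; have [_ i3] := ip.
have ifg : mu.-integrable D (EFin \o (fun t => `|f t| + `|g t|)).
  exact: (integrableD _ i1 i2).
have ih : mu.-integrable D (EFin \o (fun t => C1 * (`|f t| + `|g t|))).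
  by apply: (eq_integrable _ _ _ _ (integrableZl _ C1 ifg)).
have := hE m (fun t => C1 * (`|f t| + `|g t|)) im ih m0.
rewrite RintegralZl// (@RintegralD _ _ _ mu D (fun t => `|f t|) (fun t => `|g t|))//.
move=> hEm; rewrite -(ler_pM2l N0).
rewrite [leRHS](_ : _ = E * (C1 * (\int[mu]_(t in D) `|f t| + \int[mu]_(t in D) `|g t|))); last first.
  by field; rewrite gt_eqF.
apply: le_trans (hEm _ _) => [|t|].
- rewrite -RintegralZl//.
  by apply: le_Rintegral => // t _; rewrite lerDr.
- by apply: mulr_ge0; [exact: ltW|exact: addr_ge0].
apply: ae_imp sol => t sol Dt; have {}sol := sol Dt.
have tT : t <= T by move: Dt; rewrite /= in_itv/= => /andP[].
have imt : mu.-integrable `[0, t] (EFin \o m).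
  by apply: integrableS im => //; exact: sub.
have hp := hC0 _ _ _ _ _ l0 sol.
set F := f t + memory u p t in sol hp.
have AuE : A (u t) = F - Bt (p t).
  apply: inner_nondegenerate => v; rewrite innerBl !rep_opE -[flip b _ _]/(b v (p t)).
  by case: sol => h1 _; rewrite -h1; ring.
have hA : `|A (u t)| <= `|F| + N * `|p t|.
  by rewrite AuE (le_trans (ler_normB _ _))// lerD2l.
have hF : `|F| <= `|f t| + (K1 + K2) * \int[mu]_(s in `[0, t]) m s.
  rewrite (le_trans (ler_normD _ _))// lerD2l (le_trans (ler_normD _ _))// mulrDl.
  apply: lerD.
    apply: le_trans (volt_norm_le kap1K K1_gt0 iA tT) _; rewrite ler_wpM2l ?(ltW K1_gt0)//.
    apply: le_Rintegral => //; first by case: (bI tT iA).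
    by move=> s _; rewrite lerDl mulr_ge0// ltW.
  apply: le_trans (volt_norm_le kap2K K2_gt0 iB tT) _; rewrite ler_wpM2l ?(ltW K2_gt0)//.
  apply: le_Rintegral => //; first by case: (bI tT iB).
  by move=> s _; rewrite (le_trans (hN _))// lerDr.
have hm : m t <= C1 * (`|F| + `|g t|).
  rewrite /m /C1; have := ler_wpM2l (ltW N0) hp.
  have : 0 <= `|g t| by []. 
  move: hA; nra.
apply: le_trans hm _; rewrite -mulrA -mulrDr ler_wpM2l ?(ltW C10)//.
lra.
Qed.

Lemma u_estimate : exists2 C, 0 < C & forall L, 0 < L -> exists2 C1, 0 < C1 &
  forall l f g u p, 0 < l -> l <= L ->
  bochner_integrable D f -> bochner_integrable D g ->
  bochner_integrable D u -> bochner_integrable D p -> weak_solution l f g u p ->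
  \int[mu]_(t in `[0, T]) `|u t| <=
    C1 * \int[mu]_(t in `[0, T]) `|f t| + C * \int[mu]_(t in `[0, T]) `|g t|.
Proof.
have [C C0 hC] := saddle_primal_bound_uniform a_ge0 alpha_gt0 a_coercive beta_gt0
  b_inf_sup M_gt0 a_bounded.
have [N N0 hN] := rep_op_bound b.
(* The coefficient of the integral of |u|: in the modified second datum, B u and l p = B u - g each
   contribute N, and u = w + volt u adds K1. It is fixed before L, hence so is the Gronwall constant
   E. *)
pose Cg := C * (K1 + K2) * N + K1.
have Cg0 : 0 <= Cg by rewrite addr_ge0 ?mulr_ge0 ?addr_ge0// ltW.
have [E E0 hE] := gronwall_L1 T_ge0 Cg0.
exists (E * (C * (1 + K2 * T))) => [|L L0].
  by rewrite !mulr_gt0// ltr_wpDr// mulr_ge0// ltW.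
have [C1 C10 hC1] := hC L L0.
exists (E * C1) => [|l f g u p l0 lL i_f ig iu ip sol]; first exact: mulr_gt0.
have iB : bochner_integrable D (fun t => B (u t)) by exact: bochner_integrable_rep_op.
have ilp : bochner_integrable D (fun t => l *: p t).
  apply: (bochner_integrable_bound (c := l) mD ip).
    apply: simple_limitZ; last by case: ip.
    exact: (measurable_simple_limit (measurable_cst l)).
  by move=> t _; rewrite normrZ gtr0_norm.
pose Jg := \int[mu]_(t in D) `|g t|.
have Jg0 : 0 <= Jg by exact: Rintegral_norm_ge0.
(* The constant term comes from g in l p = B u - g, whose integral over [0, t] is at most Jg. Its
   integral over [0, T] produces K2 T in the constant for g. *)
pose h t := C1 * `|f t| + C * `|g t| + C * K2 * Jg.
have i1 : mu.-integrable D (EFin \o (fun t => C1 * `|f t|)).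
  by case: i_f => _ i_; apply: (eq_integrable _ _ _ _ (integrableZl _ C1 i_)).
have i2 : mu.-integrable D (EFin \o (fun t => C * `|g t|)).
  by case: ig => _ i_; apply: (eq_integrable _ _ _ _ (integrableZl _ C i_)).
have i12 : mu.-integrable D (EFin \o (fun t => C1 * `|f t| + C * `|g t|)).
  exact: (integrableD _ i1 i2).
have Doo : (mu D < +oo)%E := lebesgue_measure_cc_fin 0 T.
have ic : mu.-integrable D (EFin \o cst (C * K2 * Jg)).
  apply: (eq_integrable _ _ _ _ (integrableZl _ (C * K2 * Jg)
    (integrable_indic_bounded mD measurableT Doo))) => // t _ /=.
  by rewrite indicT mule1.
have ih : mu.-integrable D (EFin \o h) by exact: (integrableD _ i12 ic).
have nu : mu.-integrable D (EFin \o (fun t => `|u t|)) by case: iu.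
have muD : fine (mu D) = T.
  rewrite lebesgue_measure_itv/= lte_fin; case: ltP => [_|T_le0]; first by rewrite -EFinB/= subr0.
  by apply/eqP; rewrite eq_le T_le0 T_ge0.
have := hE (fun t => `|u t|) h nu ih.
have [_ if'] := i_f; have [_ ig'] := ig.
rewrite /h RintegralD// RintegralD// RintegralZl// RintegralZl//.
rewrite Rintegral_cst// muD -/Jg => hEu.
rewrite [leRHS](_ : _ = E * (C1 * (\int[mu]_(t in D) `|f t|) + C * Jg + C * K2 * Jg * T)); last by ring.
apply: hEu => // [t|]; first by rewrite !addr_ge0 ?mulr_ge0// ltW.
have lp_le : {ae mu, forall s, D s -> `|l *: p s| <= N * `|u s| + `|g s|}.
  apply: ae_imp sol => s sol Ds; case: (sol Ds) => _ h2.
  have -> : l *: p s = B (u s) - g s.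
    by apply: inner_nondegenerate => q; rewrite innerBl innerZl rep_opE -h2; ring.
  by rewrite (le_trans (ler_normB _ _))// lerD2r.
apply: ae_imp sol => t sol Dt; have {}sol := sol Dt.
have tT : t <= T by move: Dt; rewrite /= in_itv/= => /andP[].
pose w := u t - volt T kap1 u t; pose pi := p t - volt T kap2 p t.
pose G := g t - volt T kap1 (fun s => B (u s)) t + volt T kap2 (fun s => l *: p s) t.
(* The forms pass under the weak integrals, so the memory term is A and B^* applied to the Volterra
   integrals of u and p, exactly what is subtracted in w and pi. *)
have hw : saddle a b l (f t) G w pi.
  case: sol => h1 h2; split=> [v|q].
    have := h1 v; rewrite innerDl memoryE// /w /pi cbilinearBl cbilinearBr.
    rewrite (volt_cbilinear kap1K)//.
    rewrite -[b v (volt _ _ _ _)]/(flip b (volt T kap2 p t) v) (volt_cbilinear kap2K)//.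
    rewrite -[X in _ = _ + (_ + X) -> _]/(\int[mu]_(s in D) (kap2 t s * flip b (p s) v)).
    lra.
  rewrite /G innerDl !innerBl (voltE kap1K)// (voltE kap2K)//.
  rewrite -h2 /w /pi cbilinearBl (volt_cbilinear kap1K)// (voltE kap2K)//.
  have [mp ipq] := inner_integrable q ip.
  have -> : \int[mu]_(s in D) (kap2 t s * inner (l *: p s) q) =
      l * \int[mu]_(s in D) (kap2 t s * inner (p s) q).
    rewrite -RintegralZl//; last exact: (kernel_integrable kap2K).
    by apply: eq_Rintegral => s _; rewrite innerZl; ring.
  have -> : \int[mu]_(s in D) (kap1 t s * inner (B (u s)) q) =
      \int[mu]_(s in D) (kap1 t s * b (u s) q).
    by apply: eq_Rintegral => s _; rewrite rep_opE.
  ring.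
have {}hw := hC1 _ _ _ _ _ l0 lL hw.
pose Ju := \int[mu]_(s in `[0, t]) `|u s|.
have hu : `|u t| <= `|w| + K1 * Ju.
  rewrite {1}(_ : u t = w + volt T kap1 u t); last by rewrite subrK.
  by rewrite (le_trans (ler_normD _ _))// lerD2l (volt_norm_le kap1K).
have mI : measurable `[0, t]%classic by exact: measurable_itv.
have hB : `|volt T kap1 (fun s => B (u s)) t| <= K1 * (N * Ju).
  apply: le_trans (volt_norm_le kap1K K1_gt0 iB tT) _; rewrite ler_wpM2l ?(ltW K1_gt0)//.
  apply: Rintegral_norm_le => //; [exact: bI|exact: bI|exact: ltW|].
  by apply: aeW => s _; exact: hN.
have hlp : `|volt T kap2 (fun s => l *: p s) t| <= K2 * (N * Ju + Jg).
  apply: le_trans (volt_norm_le kap2K K2_gt0 ilp tT) _; rewrite ler_wpM2l ?(ltW K2_gt0)//.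
  have nut : mu.-integrable `[0, t] (EFin \o (fun s => `|u s|)) by case: (bI tT iu).
  have iNu : mu.-integrable `[0, t] (EFin \o (fun s => N * `|u s|)).
    by apply: (eq_integrable _ _ _ _ (integrableZl _ N nut)).
  have igt : mu.-integrable `[0, t] (EFin \o (fun s => `|g s|)) by case: (bI tT ig).
  apply: (@le_trans _ _ (\int[mu]_(s in `[0, t]) (N * `|u s| + `|g s|))).
    apply: ae_le_Rintegral => //.
    - by case: (bI tT ilp).
    - exact: (integrableD _ iNu igt).
    - by move=> s _; rewrite addr_ge0// mulr_ge0// ltW.
    - by apply: ae_imp lp_le => s hs st; apply: hs; exact: (sub tT).
  rewrite RintegralD// RintegralZl// lerD2l.
  by apply: Rintegral_subset => //; exact: sub.
have hG : `|G| <= `|g t| + K1 * (N * Ju) + K2 * (N * Ju + Jg).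
  by rewrite (le_trans (ler_normD _ _))// lerD// (le_trans (ler_normB _ _))// lerD2l.
have := ler_wpM2l (ltW C0) hG.
move: hw hu; rewrite /Cg -/Ju; lra.
Qed.

End estimates.

(** * Integrability of pairs *)

Section product_norm.
Context {R : realType} {V W : normedModType R}.
Local Notation mu := (@lebesgue_measure R).
Implicit Types x : V * W.

Lemma fst_norm_le x : `|x.1| <= `|x|.
Proof. by rewrite prod_normE le_max lexx. Qed.

Lemma snd_norm_le x : `|x.2| <= `|x|.
Proof. by rewrite prod_normE le_max lexx orbT. Qed.

Lemma prod_norm_le x (c : R) : `|x.1| <= c -> `|x.2| <= c -> `|x| <= c.
Proof. by move=> h1 h2; rewrite prod_normE ge_max h1. Qed.

Lemma bochner_integrable_fst D (h : R -> V * W) : measurable D ->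
  bochner_integrable D h -> bochner_integrable D (fun t => (h t).1).
Proof.
move=> mD; apply: (bochner_integrable_comp (c := 1) mD) => [x|x].
  exact: cvg_fst.
by rewrite mul1r fst_norm_le.
Qed.

Lemma bochner_integrable_snd D (h : R -> V * W) : measurable D ->
  bochner_integrable D h -> bochner_integrable D (fun t => (h t).2).
Proof.
move=> mD; apply: (bochner_integrable_comp (c := 1) mD) => [x|x].
  exact: cvg_snd.
by rewrite mul1r snd_norm_le.
Qed.

Lemma bochner_integrable_pair D (h : R -> V) (h' : R -> W) : measurable D ->
  bochner_integrable D h -> bochner_integrable D h' ->
  bochner_integrable D (fun t => (h t, h' t)).
Proof.
move=> mD [lh ih] [lh' ih']; split; first exact: simple_limit_pair.
apply: (@dominated_integrable _ _ _ (fun t => `|h t| + `|h' t|)) => //.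
- by apply: simple_limit_norm; exact: simple_limit_pair.
- exact: (integrableD _ ih ih').
- by move=> t _; rewrite normr_id; apply: prod_norm_le; rewrite /= ?lerDl ?lerDr.
Qed.

Lemma continuous_bochner_integrable (T : R) (z : R -> V) :
  continuous z -> bochner_integrable `[0, T] z.
Proof.
move=> cz; split; first exact: continuous_simple_limit.
apply: continuous_compact_integrable; first exact: segment_compact.
by apply: continuous_subspaceT => t; apply: cvg_norm; exact: cz.
Qed.

End product_norm.

(** * Existence for the weak problem *)

Section existence.
Context {R : realType} {V Q : hilbertType R}.
Variables (a : cbilinear V V) (b : cbilinear V Q).
Variables (T K1 K2 : R) (kap1 kap2 : R -> R -> R).
Hypothesis T_ge0 : 0 <= T.
Hypothesis kap1K : memory_kernel K1 kap1.
Hypothesis K1_gt0 : 0 < K1.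
Hypothesis kap2K : memory_kernel K2 kap2.
Hypothesis K2_gt0 : 0 < K2.
Implicit Types (u f z : R -> V) (p g : R -> Q) (t l : R).

Local Notation mu := (@lebesgue_measure R).
Local Notation D := (`[0, T]%classic).
Local Notation mem := (memory a b T kap1 kap2).

Let mD : measurable D. Proof. exact: measurable_itv. Qed.

Lemma memoryB u p u' p' t :
  bochner_integrable D u -> bochner_integrable D p ->
  bochner_integrable D u' -> bochner_integrable D p' ->
  mem u p t - mem u' p' t = mem (fun s => u s - u' s) (fun s => p s - p' s) t.
Proof.
move=> iu ip iu' ip'; rewrite /memory opprD addrACA.
rewrite (voltB kap1K) ?(voltB kap2K); try exact: bochner_integrable_rep_op.
congr (volt _ _ _ _ + volt _ _ _ _); apply/funext => s; by rewrite rep_opB.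
Qed.

(** Stated with a majorant w, which is a multiple of the exponential weight in the contraction
    estimate and the norm of the pair in the bound on the first iterate. *)
Lemma memory_norm_le : exists2 C, 0 < C & forall u p (w : R -> R) t,
  bochner_integrable D u -> bochner_integrable D p -> t <= T ->
  mu.-integrable `[0, t] (EFin \o w) ->
  (forall s, 0 <= s <= t -> `|u s| <= w s) -> (forall s, 0 <= s <= t -> `|p s| <= w s) ->
  `|mem u p t| <= C * \int[mu]_(s in `[0, t]) w s.
Proof.
have [M M0 hM] := rep_op_bound a; have [N N0 hN] := rep_op_bound (flip b).
exists (K1 * M + K2 * N); first by rewrite addr_gt0// mulr_gt0.
move=> u p w t iu ip tT iw uw pw.
have sub : `[0, t]%classic `<=` D.
  by move=> s /=; rewrite !in_itv/= => /andP[-> st]; exact: le_trans tT.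
have iA := bochner_integrable_rep_op a mD iu.
have iB := bochner_integrable_rep_op (flip b) mD ip.
have [_ iA'] := bochner_integrableS mD (measurable_itv _) sub iA.
have [_ iB'] := bochner_integrableS mD (measurable_itv _) sub iB.
have le_w (c : R) (W : hilbertType R) (h : R -> W) : 0 <= c ->
    mu.-integrable `[0, t] (EFin \o (fun s => `|h s|)) ->
    (forall s, 0 <= s <= t -> `|h s| <= c * w s) ->
    \int[mu]_(s in `[0, t]) `|h s| <= c * \int[mu]_(s in `[0, t]) w s.
  move=> c0 ih hw; rewrite -RintegralZl//; apply: le_Rintegral => //.
  by apply: (eq_integrable _ _ _ _ (integrableZl _ c iw)).
rewrite mulrDl /memory; apply: le_trans (ler_normD _ _) _; rewrite -!mulrA lerD//.
- apply: le_trans (volt_norm_le kap1K K1_gt0 iA tT) _; rewrite ler_wpM2l ?(ltW K1_gt0)//.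
  apply: le_w => //; first exact: ltW.
  by move=> s st; rewrite (le_trans (hM _))// ler_wpM2l ?(ltW M0)// uw.
- apply: le_trans (volt_norm_le kap2K K2_gt0 iB tT) _; rewrite ler_wpM2l ?(ltW K2_gt0)//.
  apply: le_w => //; first exact: ltW.
  by move=> s st; rewrite (le_trans (hN _))// ler_wpM2l ?(ltW N0)// pw.
Qed.

Lemma memory_continuous u p : bochner_integrable D u -> bochner_integrable D p ->
  continuous (mem u p).
Proof.
move=> iu ip t; apply: cvgD.
  by apply: (volt_continuous kap1K); exact: bochner_integrable_rep_op.
by apply: (volt_continuous kap2K); exact: bochner_integrable_rep_op.
Qed.

Lemma saddleB l (F F' : V) (G G' : Q) (u u' : V) (p p' : Q) :
  saddle a b l F G u p -> saddle a b l F' G' u' p' ->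
  saddle a b l (F - F') (G - G') (u - u') (p - p').
Proof.
move=> [h1 h2] [h1' h2']; split=> [v|q]; rewrite !innerBl.
  by rewrite -h1 -h1' cbilinearBl cbilinearBr; ring.
by rewrite -h2 -h2' cbilinearBl; ring.
Qed.

Variables (l L : R) (S : V * Q -> V * Q).
Hypothesis S_saddle : forall x, saddle a b l x.1 x.2 (S x).1 (S x).2.
Hypothesis L_gt0 : 0 < L.
Hypothesis S_lip : forall x y, `|S x - S y| <= L * `|x - y|.
Hypothesis S_bound : forall x, `|S x| <= L * `|x|.

(** For a candidate memory z, S gives the pair solving the stationary problem with data f + z and g,
    and N z is the memory of that pair. A fixed point on [0, T] is a consistent memory, and its pair
    solves the problem. *)
Lemma weak_solution_exists f g : bochner_integrable D f -> bochner_integrable D g ->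
  exists u p, [/\ bochner_integrable D u, bochner_integrable D p &
    weak_solution a b T kap1 kap2 l f g u p].
Proof.
move=> i_f ig.
pose U z t := S (f t + z t, g t).
have iU z : continuous z -> bochner_integrable D (U z).
  move=> cz; apply: (bochner_integrable_comp (c := L) mD) => //.
    exact: (lipschitz_continuous S_lip).
  apply: bochner_integrable_pair => //; apply: bochner_integrableD => //.
  exact: continuous_bochner_integrable.
have iU1 z : continuous z -> bochner_integrable D (fun t => (U z t).1).
  by move=> cz; apply: bochner_integrable_fst => //; exact: iU.
have iU2 z : continuous z -> bochner_integrable D (fun t => (U z t).2).
  by move=> cz; apply: bochner_integrable_snd => //; exact: iU.
pose N z := mem (fun t => (U z t).1) (fun t => (U z t).2).
have [C C0 hC] := memory_norm_le.
(* Integrating exp (c s) gains 1 / c, and C L / c = 1 / 2 is the contraction factor. *)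
pose c := 2 * (C * L); have c0 : 0 < c by rewrite !mulr_gt0.
have [||z z' e cz cz' e0 zz' t /andP[t0 tT]|t /andP[t0 tT]|z cz Nz] := @weighted_fixpoint R V T (expR (c * T))
  (C * \int[mu]_(s in `[0, T]) `|U (cst 0) s|) (fun s => expR (c * s)) N T_ge0.
- move=> s /andP[s0 sT]; rewrite -[X in X <= _]expR0 !ler_expR mulr_ge0 ?(ltW c0)//=.
  by rewrite ler_wpM2l// ltW.
- by move=> z cz; apply: memory_continuous; [exact: iU1|exact: iU2].
- rewrite memoryB; [|exact: iU1|exact: iU2|exact: iU1|exact: iU2].
  have [iexp hexp] := integral_exp_weight c0 t0.
  have iw : mu.-integrable `[0, t] (EFin \o (fun s => L * e * expR (c * s))).
    by apply: (eq_integrable _ _ _ _ (integrableZl _ (L * e) iexp)).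
  have Uw s : 0 <= s <= t -> `|U z s - U z' s| <= L * e * expR (c * s).
    move=> /andP[s0 st]; apply: le_trans (S_lip _ _) _; rewrite -mulrA ler_wpM2l ?(ltW L_gt0)//.
    apply: le_trans (zz' s _); last by rewrite s0 (le_trans st).
    apply: prod_norm_le => /=; last by rewrite subrr normr0.
    by rewrite opprD addrACA subrr add0r.
  apply: le_trans (hC _ _ _ _ _ _ tT iw _ _) _.
  + by apply: bochner_integrableB => //; exact: iU1.
  + by apply: bochner_integrableB => //; exact: iU2.
  + by move=> s st; apply: le_trans (Uw s st); exact: (fst_norm_le (U z s - U z' s)).
  + by move=> s st; apply: le_trans (Uw s st); exact: (snd_norm_le (U z s - U z' s)).
  rewrite RintegralZl//; move: hexp; move: (\int[mu]_(s in _) _) => I hI.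
  rewrite (_ : C * _ = e / 2 * (c * I)); last by rewrite /c; field.
  by rewrite ler_wpM2l// divr_ge0.
- have [_ iUn] := iU (cst 0) (@cst_continuous _ _ _).
  have sub : `[0, t]%classic `<=` D.
    by move=> s /=; rewrite !in_itv/= => /andP[-> st]; exact: le_trans tT.
  apply: (@le_trans _ _ (C * \int[mu]_(s in `[0, t]) `|U (cst 0) s|)).
    apply: hC => //.
    + by apply: iU1; exact: cst_continuous.
    + by apply: iU2; exact: cst_continuous.
    + by apply: integrableS iUn => //; exact: measurable_itv.
    + by move=> s _; exact: fst_norm_le.
    + by move=> s _; exact: snd_norm_le.
  rewrite ler_wpM2l ?(ltW C0)//; apply: Rintegral_subset => //; exact: measurable_itv.
exists (fun t => (U z t).1), (fun t => (U z t).2); split; [exact: iU1|exact: iU2|].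
apply: aeW => t /=; rewrite in_itv/= => tT.
rewrite -/(N z t) Nz//; exact: (S_saddle (f t + z t, g t)).
Qed.

End existence.

(** * The solution operator of the stationary problem *)

Section saddle_solver.
Context {R : realType} {V Q : hilbertType R}.
Variables (a : cbilinear V V) (b : cbilinear V Q) (alpha beta M : R).
Hypothesis a_sym : forall w v, a w v = a v w.
Hypothesis a_ge0 : forall v, 0 <= a v v.
Hypothesis alpha_gt0 : 0 < alpha.
Hypothesis a_coercive : forall v, (forall q, b v q = 0) -> alpha * `|v| ^+ 2 <= a v v.
Hypothesis beta_gt0 : 0 < beta.
Hypothesis b_inf_sup : inf_sup b beta.
Hypothesis M_gt0 : 0 < M.
Hypothesis a_bounded : forall v w, `|a v w| <= M * `|v| * `|w|.

(** Solutions are chosen one datum at a time. The bound applied to differences of solutions makes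
    the choice Lipschitz, hence compatible with measurability in t. Here L may depend on l. *)
Lemma saddle_solver (l : R) : 0 < l -> exists (S : V * Q -> V * Q) (L : R),
  [/\ 0 < L, forall x, saddle a b l x.1 x.2 (S x).1 (S x).2,
      forall x y, `|S x - S y| <= L * `|x - y| & forall x, `|S x| <= L * `|x|].
Proof.
move=> l0.
have /choice[S hS] (x : V * Q) := saddle_exists a_sym a_ge0 alpha_gt0 a_coercive beta_gt0
  b_inf_sup M_gt0 a_bounded x.1 x.2 l0.
have [C0 C00 hC0] := saddle_dual_bound a_sym a_ge0 alpha_gt0 a_coercive beta_gt0
  b_inf_sup M_gt0 a_bounded.
have [C C_0 hC] := saddle_primal_bound_uniform a_ge0 alpha_gt0 a_coercive beta_gt0
  b_inf_sup M_gt0 a_bounded.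
have [C1 C10 hC1] := hC l l0.
pose L := C1 + C + 2 * C0.
have bound (x y : V * Q) : saddle a b l x.1 x.2 y.1 y.2 -> `|y| <= L * `|x|.
  move=> h; have h1 := hC1 _ _ _ _ _ l0 (lexx l) h; have h2 := hC0 _ _ _ _ _ l0 h.
  have := fst_norm_le x; have := snd_norm_le x; rewrite /L => x2 x1.
  have x0 : 0 <= `|x| by [].
  have := ler_wpM2l (ltW C10) x1; have := ler_wpM2l (ltW C_0) x2.
  have := ler_wpM2l (ltW C00) x1; have := ler_wpM2l (ltW C00) x2.
  have := mulr_ge0 (ltW C10) x0; have := mulr_ge0 (ltW C_0) x0; have := mulr_ge0 (ltW C00) x0.
  move=> *; apply: prod_norm_le; lra.
exists S, L; split => //; first by rewrite !addr_gt0// mulr_gt0.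
- by move=> x y; apply: bound; exact: saddleB (hS x) (hS y).
- by move=> x; exact: bound.
Qed.

End saddle_solver.

(** * From the Bochner formulation to the weak one *)

Section solutions.
Context {R : realType}.
Local Notation mu := (@lebesgue_measure R).

Lemma strongly_measurable_ae_eq (B : normedModType R) (D : set R) (h h' : R -> B) :
  measurable D -> (mu D < +oo)%E -> simple_limit h' ->
  {ae mu, forall t, D t -> h' t = h t} -> strongly_measurable D h.
Proof.
move=> mD Doo lh' hh'; have [s [ss sh]] := simple_limit_strongly_measurable mD Doo lh'.
exists s; split=> //; apply: ae_imp (ae_and sh hh') => t [h1 h2] Dt.
by rewrite -h2//; exact: h1.
Qed.

Lemma ae_eq0_Rintegral_norm (B : normedModType R) (D : set R) (h : R -> B) : measurable D ->
  bochner_integrable D h -> \int[mu]_(t in D) `|h t| <= 0 ->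
  {ae mu, forall t, D t -> h t = 0}.
Proof.
move=> mD [lh ih] h0.
have mh : measurable_fun D (fun t => `|h t|%:E).
  by apply/measurable_EFinP; apply: measurable_funTS; exact: simple_limit_norm.
have e : (\int[mu]_(t in D) `| `|h t|%:E | = 0)%E.
  under eq_integral do rewrite /= normr_id.
  rewrite -[LHS]fineK; last exact: integrable_fin_num.
  congr EFin; apply/eqP; rewrite eq_le h0/=; exact: Rintegral_norm_ge0.
have [+ _] : (\int[mu]_(t in D) `| `|h t|%:E | = 0)%E <->
    ae_eq mu D (fun t => `|h t|%:E) (cst 0%E) by exact: ae_eq_integral_abs.
move=> /(_ e); apply: ae_imp => t ht Dt; apply/eqP; rewrite -normr_eq0; apply/eqP.
by case: (ht Dt).
Qed.

(** Two codomains occur because dual-valued data are compared with their Riesz representatives,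
    which have the same norm. *)
Lemma L1norm_Rintegral (B C : normedModType R) (D : set R) (h : R -> B) (h' : R -> C) :
  measurable D -> bochner_integrable D h' ->
  {ae mu, forall t, D t -> `|h' t| = `|h t|} ->
  L1norm D h = (\int[mu]_(t in D) `|h' t|)%:E.
Proof.
move=> mD [lh' ih'] hh'.
have -> : L1norm D h = L1norm D h'.
  apply: integral_ae_measurable => //.
    by apply/measurable_EFinP; apply: measurable_funTS; exact: simple_limit_norm.
  by apply: ae_imp hh' => t e /e ->.
by rewrite /L1norm /Rintegral fineK//; exact: integrable_fin_num.
Qed.

Section form_op_theory.
Context {V W : normedModType R}.
Variable b : cbilinear V W.

Lemma form_opB v v' : form_op b (v - v') = form_op b v - form_op b v'.
Proof. by apply: dual_eqP => w; exact: cbilinearBl. Qed.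

Lemma form_op_bound : exists2 M, 0 < M & forall v, `|form_op b v| <= M * `|v|.
Proof.
have [M M0 hM] := cbilinear_bounded b; exists M => // v.
by apply: dual_norm_lub => [|w]; [rewrite mulr_ge0// ltW|exact: hM].
Qed.

Lemma form_op_continuous : continuous (form_op b).
Proof.
have [M M0 hM] := form_op_bound; apply: (@lipschitz_continuous _ _ _ _ M) => x y.
by rewrite -form_opB.
Qed.

End form_op_theory.

Lemma rep_continuous (V : hilbertType R) : continuous (@rep R V).
Proof.
apply: (@lipschitz_continuous _ _ _ _ 1) => x y.
by rewrite mul1r -[- rep y]scaleN1r -repZ -repD rep_norm scaleN1r.
Qed.

Lemma bochner_integrable_rep (V : hilbertType R) (D : set R) (h : R -> dual V) :
  measurable D -> bochner_integrable D h -> bochner_integrable D (fun t => rep (h t)).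
Proof.
move=> mD; apply: (bochner_integrable_comp (c := 1) mD); first exact: rep_continuous.
by move=> x; rewrite rep_norm mul1r.
Qed.

Context {V Q : hilbertType R}.
Variables (a : cbilinear V V) (b : cbilinear V Q).
Variables (T K1 K2 : R) (k1 k2 kap1 kap2 : R -> R -> R).
Hypothesis kap1K : memory_kernel K1 kap1.
Hypothesis kap1E : forall t s, 0 <= s -> s <= t -> t <= T -> kap1 t s = k1 t s.
Hypothesis kap2K : memory_kernel K2 kap2.
Hypothesis kap2E : forall t s, 0 <= s -> s <= t -> t <= T -> kap2 t s = k2 t s.
Local Notation D := (`[0, T]%classic).

Let mD : measurable D. Proof. exact: measurable_itv. Qed.

(** Evaluation at v turns the Bochner integral into a scalar integral over [0, t], which the
    extension of the kernels by zero carries to [0, T]. Passing to the representative up' changes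
    the integrand on a null set only. *)
Lemma bochner_integral_memory (up up' : R -> V * Q) (t : R) (v : V) :
  bochner_integrable D up' -> {ae mu, forall s, D s -> up' s = up s} ->
  0 <= t <= T ->
  bochner_integral `[0, t] (fun s => k1 t s *: form_op a (up s).1 +
      k2 t s *: form_op (flip b) (up s).2) v =
  inner (memory a b T kap1 kap2 (fun s => (up' s).1) (fun s => (up' s).2) t) v.
Proof.
move=> iup upE /andP[t0 tT].
have sub : `[0, t]%classic `<=` D.
  by move=> s /=; rewrite !in_itv/= => /andP[-> st]; exact: le_trans tT.
have iu := bochner_integrable_fst mD iup; have ip := bochner_integrable_snd mD iup.
pose h' s : dual V := kap1 t s *: form_op a (up' s).1 + kap2 t s *: form_op (flip b) (up' s).2.
have [mk1 bk1 k10 _] := kap1K; have [mk2 bk2 k20 _] := kap2K.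
have lh' : simple_limit h'.
  apply: simple_limitD; apply: simple_limitZ.
  - exact: measurable_simple_limit.
  - by apply: (simple_limit_comp (@form_op_continuous _ _ a)); case: iu.
  - exact: measurable_simple_limit.
  - by apply: (simple_limit_comp (@form_op_continuous _ _ (flip b))); case: ip.
have ih' : bochner_integrable `[0, t] h'.
  have [M M0 hM] := form_op_bound a; have [N N0 hN] := form_op_bound (flip b).
  apply: (bochner_integrable_bound (c := K1 * M + K2 * N) _
    (bochner_integrableS mD (measurable_itv _) sub iup)) => // s _.
  rewrite (le_trans (ler_normD _ _))// mulrDl lerD// normrZ -mulrA; apply: ler_pM => //.
    by rewrite (le_trans (hM _))// ler_wpM2l ?(ltW M0)// fst_norm_le.
  by rewrite (le_trans (hN _))// ler_wpM2l ?(ltW N0)// snd_norm_le.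
have hh' : {ae mu, forall s, `[0, t]%classic s -> h' s = k1 t s *: form_op a (up s).1 +
    k2 t s *: form_op (flip b) (up s).2}.
  apply: ae_imp upE => s us st; rewrite /h' us; last exact: sub.
  by move: st => /=; rewrite in_itv/= => /andP[s0 st]; rewrite kap1E// kap2E.
have mI : measurable `[0, t]%classic by exact: measurable_itv.
have Ioo := lebesgue_measure_cc_fin 0 t.
rewrite (bochner_integral_dualE mI Ioo ih' hh')//; last first.
  exact: strongly_measurable_ae_eq lh' hh'.
rewrite (memoryE _ _ kap1K kap2K)//.
have [m1 i1] := inner_integrable v (bochner_integrable_rep_op a mD iu).
have [m2 i2] := inner_integrable v (bochner_integrable_rep_op (flip b) mD ip).
have e1 : \int[mu]_(s in D) (kap1 t s * inner (rep_op a (up' s).1) v) =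
    \int[mu]_(s in D) (kap1 t s * a (up' s).1 v).
  by apply: eq_Rintegral => s _; rewrite rep_opE.
have e2 : \int[mu]_(s in D) (kap2 t s * inner (rep_op (flip b) (up' s).2) v) =
    \int[mu]_(s in D) (kap2 t s * b v (up' s).2).
  by apply: eq_Rintegral => s _; rewrite rep_opE.
rewrite -e1 -e2 -RintegralD//; [|exact: (kernel_integrable kap1K t m1 i1)|exact: (kernel_integrable kap2K t m2 i2)].
rewrite (Rintegral_memory tT) => [|s st]; last first.
  by rewrite k10// k20// !mul0r addr0.
by apply: eq_Rintegral => s _; rewrite !rep_opE.
Qed.

(** The memory depends only on the almost everywhere class of the pair, so the two systems agree at
    almost every t; an equation in the dual is the same as its tested form. *)
Lemma volterra_solutionP (l : R) (f f' : R -> dual V) (g g' : R -> dual Q)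
    (up up' : R -> V * Q) : bochner_integrable D up' ->
  {ae mu, forall t, D t -> up' t = up t} -> {ae mu, forall t, D t -> f' t = f t} ->
  {ae mu, forall t, D t -> g' t = g t} ->
  volterra_solution a b T k1 k2 l f g up <->
  weak_solution a b T kap1 kap2 l (fun t => rep (f' t)) (fun t => rep (g' t))
    (fun t => (up' t).1) (fun t => (up' t).2).
Proof.
move=> iup upE fE gE.
suff pw : {ae mu, forall t, D t ->
    (form_op a (up t).1 + form_op (flip b) (up t).2 = f t + bochner_integral `[0, t]
      (fun s => k1 t s *: form_op a (up s).1 + k2 t s *: form_op (flip b) (up s).2) /\
     form_op b (up t).1 - l *: riesz (up t).2 = g t) <->
    saddle a b l (rep (f' t) + memory a b T kap1 kap2 (fun s => (up' s).1)
      (fun s => (up' s).2) t) (rep (g' t)) (up' t).1 (up' t).2}.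
  split=> sol; apply: ae_imp (ae_and pw sol) => t [h1 h2] Dt.
    by apply/(h1 Dt); exact: h2.
  by apply/(h1 Dt); exact: h2.
apply: ae_imp (ae_and upE (ae_and fE gE)) => t [h1 [h2 h3]] Dt.
have tT : 0 <= t <= T by move: Dt; rewrite /= in_itv.
rewrite h1// h2// h3//; split=> -[e1 e2]; split.
- move=> v; rewrite innerDl repE -(bochner_integral_memory v iup upE tT).
  exact: (congr1 (fun F : dual V => F v : R) e1).
- by move=> q; rewrite repE; exact: (congr1 (fun F : dual Q => F q : R) e2).
- apply: dual_eqP => v; have := e1 v.
  by rewrite innerDl repE -(bochner_integral_memory v iup upE tT).
- by apply: dual_eqP => q; have := e2 q; rewrite repE.
Qed.

Lemma weak_solutionB (l : R) (f : R -> V) (g : R -> Q) (u u' : R -> V) (p p' : R -> Q) :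
  bochner_integrable D u -> bochner_integrable D p ->
  bochner_integrable D u' -> bochner_integrable D p' ->
  weak_solution a b T kap1 kap2 l f g u p -> weak_solution a b T kap1 kap2 l f g u' p' ->
  weak_solution a b T kap1 kap2 l (cst 0) (cst 0)
    (fun t => u t - u' t) (fun t => p t - p' t).
Proof.
move=> iu ip iu' ip' sol sol'; apply: ae_imp (ae_and sol sol') => t [h h'] Dt.
have := saddleB (h Dt) (h' Dt).
by rewrite subrr opprD addrACA subrr (memoryB a b kap1K kap2K).
Qed.

End solutions.

(* The bounds hold with C2, C3, C4 independent of lambda > 0 and with C1
   uniform on every bounded range 0 < lambda <= Lambda.  No C1 works for all
   lambda > 0: if V = Q = R, b v q = v * q, a = 0 and k1 = k2 = 0, then the
   solution is p = f, u = g + lambda * f. *)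
Theorem theorem2p5 (R : realType) (V Q : hilbertType R)
    (a : cbilinear V V) (b : cbilinear V Q)
    (T : R) (k1 k2 : R -> R -> R)
    (T_ge0 : 0 <= T)
    (a_sym : forall w v, a w v = a v w)
    (a_ge0 : forall v, 0 <= a v v)
    (a_coercive : exists2 alpha0 : R, 0 < alpha0 &
      forall v0 : V, form_op b v0 = 0 -> alpha0 * `|v0| ^+ 2 <= a v0 v0)
    (b_inf_sup : exists2 beta : R, 0 < beta & inf_sup b beta)
    (k1_kernel : kernel_on_triangle T k1)
    (k2_kernel : kernel_on_triangle T k2) :
  (forall (lambda : R) (f : R -> dual V) (g : R -> dual Q),
    0 < lambda -> L1 `[0, T] f -> L1 `[0, T] g ->
    exists up : R -> V * Q,
      [/\ L1 `[0, T] up,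
          volterra_solution a b T k1 k2 lambda f g up &
          forall up' : R -> V * Q, L1 `[0, T] up' ->
            volterra_solution a b T k1 k2 lambda f g up' ->
            {ae @lebesgue_measure R, forall t,
              `[0, T]%classic t -> up' t = up t}])
  /\
  (exists C2 C3 C4 : R, [/\ 0 < C2, 0 < C3 & 0 < C4] /\
    forall Lambda : R, 0 < Lambda -> exists2 C1 : R, 0 < C1 &
      forall (lambda : R) (f : R -> dual V) (g : R -> dual Q)
          (up : R -> V * Q),
        0 < lambda -> lambda <= Lambda ->
        L1 `[0, T] f -> L1 `[0, T] g -> L1 `[0, T] up ->
        volterra_solution a b T k1 k2 lambda f g up ->
        (L1norm `[0%R, T] (fun t => (up t).1)
           <= C1%:E * L1norm `[0%R, T] f + C2%:E * L1norm `[0%R, T] g)%E /\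
        (L1norm `[0%R, T] (fun t => (up t).2)
           <= C3%:E * L1norm `[0%R, T] f + C4%:E * L1norm `[0%R, T] g)%E).
Proof.
have mD : measurable `[0, T]%classic by exact: measurable_itv.
have Doo := lebesgue_measure_cc_fin 0 T.
have [alpha alpha0 a_coer] := a_coercive.
have {}a_coer v : (forall q, b v q = 0) -> alpha * `|v| ^+ 2 <= a v v.
  by move=> bv; apply: a_coer; apply: dual_eqP => q; exact: bv.
have [beta beta0 b_is] := b_inf_sup.
have [M M0 aM] := cbilinear_bounded a.
have [K1 [kap1 [K10 kap1K kap1E]]] := kernel_extension T_ge0 k1_kernel.
have [K2 [kap2 [K20 kap2K kap2E]]] := kernel_extension T_ge0 k2_kernel.
have solP := volterra_solutionP a b kap1K kap1E kap2K kap2E.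
have [Cp Cp0 hCp] := p_estimate a_sym a_ge0 alpha0 a_coer beta0 b_is M0 aM T_ge0
  kap1K K10 kap2K K20.
have [Cu Cu0 hCu] := u_estimate a_ge0 alpha0 a_coer beta0 b_is M0 aM T_ge0
  kap1K K10 kap2K K20.
split=> [l f g l0 Lf Lg|].
  have [f' [i_f _ fE]] := L1_bochner_integrable mD Lf.
  have [g' [ig _ gE]] := L1_bochner_integrable mD Lg.
  have [S [L [L0 hS Slip Sb]]] := saddle_solver a_sym a_ge0 alpha0 a_coer beta0 b_is M0 aM l0.
  have [u [p [iu ip sol]]] := weak_solution_exists T_ge0 kap1K K10 kap2K K20 hS L0 Slip Sb
    (bochner_integrable_rep mD i_f) (bochner_integrable_rep mD ig).
  have iup : bochner_integrable `[0, T] (fun t => (u t, p t)).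
    exact: bochner_integrable_pair.
  exists (fun t => (u t, p t)); split.
  - exact: bochner_integrable_L1.
  - apply/(solP l f f' g g' _ (fun t => (u t, p t)) iup _ fE gE) => //.
    exact: aeW.
  move=> up2 Lup2 sol2.
  have [up2' [iup2 _ up2E]] := L1_bochner_integrable mD Lup2.
  have {}sol2 := (solP l f f' g g' _ _ iup2 up2E fE gE).1 sol2.
  have iu2 := bochner_integrable_fst mD iup2; have ip2 := bochner_integrable_snd mD iup2.
  have dsol := weak_solutionB kap1K kap2K iu2 ip2 iu ip sol2 sol.
  have i0 (W : normedModType R) : bochner_integrable `[0, T] (cst 0 : R -> W).
    by apply: continuous_bochner_integrable; exact: cst_continuous.
  have int0 (W : normedModType R) :
      \int[lebesgue_measure]_(t in `[0, T]) `|(cst 0 : R -> W) t| = 0.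
    by under eq_Rintegral do rewrite normr0; rewrite Rintegral_cst// mul0r.
  have idu := bochner_integrableB mD iu2 iu; have idp := bochner_integrableB mD ip2 ip.
  (* For uniqueness lambda is fixed and serves as its own upper bound. *)
  have [C1 C10 hC1] := hCu l l0.
  have du0 := hC1 _ _ _ _ _ l0 (lexx l) (i0 V) (i0 Q) idu idp dsol.
  have dp0 := hCp _ _ _ _ _ l0 (i0 V) (i0 Q) idu idp dsol.
  rewrite !int0 ?addr0 !mulr0 ?addr0 in du0 dp0.
  have eu := ae_eq0_Rintegral_norm mD idu du0; have ep := ae_eq0_Rintegral_norm mD idp dp0.
  apply: ae_imp (ae_and up2E (ae_and eu ep)) => t [h1 [h2 h3]] Dt.
  rewrite -h1//; have /eqP := h2 Dt; have /eqP := h3 Dt; rewrite !subr_eq0.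
  by case: (up2' t) => /= x y /eqP -> /eqP ->.
(* [Cu] was obtained before any bound on lambda was chosen; [Cp] multiplies the sum of both data
   norms and so serves as C3 and as C4. *)
exists Cu, Cp, Cp; split => // L L0.
have [C1 C10 hC1] := hCu L L0; exists C1 => // l f g up l0 lL Lf Lg Lup sol.
have [f' [i_f _ fE]] := L1_bochner_integrable mD Lf.
have [g' [ig _ gE]] := L1_bochner_integrable mD Lg.
have [up' [iup _ upE]] := L1_bochner_integrable mD Lup.
have {}sol := (solP l f f' g g' _ _ iup upE fE gE).1 sol.
have iu := bochner_integrable_fst mD iup; have ip := bochner_integrable_snd mD iup.
have jf := bochner_integrable_rep mD i_f; have jg := bochner_integrable_rep mD ig.
rewrite (L1norm_Rintegral (h := f) mD jf); last first.
  by apply: ae_imp fE => t e Dt; rewrite rep_norm e.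
rewrite (L1norm_Rintegral (h := g) mD jg); last first.
  by apply: ae_imp gE => t e Dt; rewrite rep_norm e.
rewrite (L1norm_Rintegral mD iu); last by apply: ae_imp upE => t e Dt; rewrite e.
rewrite (L1norm_Rintegral mD ip); last by apply: ae_imp upE => t e Dt; rewrite e.
rewrite -!EFinM -!EFinD !lee_fin -mulrDr.
by split; [exact: (hC1 _ _ _ _ _ l0 lL jf jg iu ip sol)|exact: (hCp _ _ _ _ _ l0 jf jg iu ip sol)].
Qed.
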